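(* Let $p$ be a prime and let $\phi(x)=\frac{ax+b}{cx+d}$ with $a,b,c,d\in\mathbb{Q}_p$, $ad-bc\neq 0$, regarded as a map $\mathbb{P}^1(\mathbb{Q}_p)\to\mathbb{P}^1(\mathbb{Q}_p)$. Suppose that $\phi$ has no fixed point in $\mathbb{P}^1(\mathbb{Q}_p)$ and that $\phi^n\neq \mathrm{id}$ for all integers $n>0$. Then the system $(\mathbb{P}^1(\mathbb{Q}_p),\phi)$ is decomposed into a finite number of minimal subsystems. These minimal subsystems are topologically conjugate to each other. The number of minimal subsystems is determined by (i.e. depends only on) the number $$\lambda:=\frac{a+d+\sqrt{\Delta}}{a+d-\sqrt{\Delta}},\qquad \Delta=(d-a)^2+4bc .$$
   Context: $\mathbb{P}^1(\mathbb{Q}_p)=\mathbb{Q}_p\cup\{\infty\}$ is the projective line over $\mathbb{Q}_p$ with its usual compact topology. $\sqrt{\Delta}$ is a fixed square root of $\Delta$ in an algebraic closure of $\mathbb{Q}_p$, so $\lambda\in\mathbb{Q}_p(\sqrt{\Delta})$. If $E$ is a compact subset of $\mathbb{P}^1(\mathbb{Q}_p)$ with $\phi(E)\subset E$, then $(E,\phi)$ is called a subsystem; it is minimal if $E=\overline{\{\phi^n(x):n\ge 0\}}$ for every $x\in E$. ''Decomposed into $M$ minimal subsystems'' means that $\mathbb{P}^1(\mathbb{Q}_p)$ is the disjoint union of $M$ nonempty compact $\phi$-invariant sets, on each of which $\phi$ is minimal. Here $p$ (hence $\mathbb{Q}_p$) is fixed. *)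

(* Defs.v *)
From HB Require Import structures.
From mathcomp Require Import all_boot all_order all_algebra.
From mathcomp Require Import all_classical reals topology normedtype sequences.

Set Implicit Arguments.
Unset Strict Implicit.
Unset Printing Implicit Defensive.

Import Order.TTheory GRing.Theory Num.Theory.
Import numFieldNormedType.Exports.

Local Open Scope classical_set_scope.
Local Open Scope ring_scope.

Section PadicAbs.
Variable p : nat.

Definition padic_val (x : rat) : int :=
  (logn p `|numq x|)%:Z - (logn p `|denq x|)%:Z.

(* [logn p] vanishes when [p] is not prime, so that [padic_abs p] is then the
   trivial absolute value; this is why [p] need not be assumed prime below. *)
Definition padic_abs (x : rat) : rat :=
  if x == 0 then 0 else p%:R ^ (- padic_val x).

Lemma padic_abs0 : padic_abs 0 = 0.
Proof. by rewrite /padic_abs eqxx. Qed.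

Lemma padic_val_np x : ~~ prime p -> padic_val x = 0.
Proof.
move=> /negbTE np; have np' n : logn p n = 0%N by rewrite lognE np.
by rewrite /padic_val !np'.
Qed.

Lemma padic_val_div (a b : int) : a != 0 -> b != 0 ->
  padic_val (a%:~R / b%:~R) = (logn p `|a|)%:Z - (logn p `|b|)%:Z.
Proof.
move=> a0 b0; rewrite /padic_val; set x := (_ / _ : rat).
have x0 : x != 0 by rewrite mulf_neq0 ?invr_eq0 ?intr_eq0.
have E : (a * denq x = numq x * b)%R.
  apply/eqP; rewrite -(eqr_int rat) !rmorphM /=.
  have -> : (numq x)%:~R = x * (denq x)%:~R :> rat by rewrite numqE.
  by rewrite mulrAC /x divfK ?intr_eq0 // mulrC.
have /(congr1 (fun z => logn p z)) := congr1 absz E.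
rewrite !abszM !lognM ?absz_gt0 ?numq_eq0 ?denq_eq0 //; last first.
move=> H; apply/eqP; rewrite subr_eq addrAC eq_sym subr_eq -!PoszD.
by rewrite H.
Qed.

Lemma padic_abs_gt0 x : x != 0 -> 0 < padic_abs x.
Proof.
move=> x0; rewrite /padic_abs (negbTE x0).
case pp : (prime p); last by rewrite padic_val_np ?pp // oppr0 expr0z.
by rewrite exprz_gt0 // ltr0n prime_gt0.
Qed.

Lemma padic_abs_ge0 x : 0 <= padic_abs x.
Proof.
by have [->|/padic_abs_gt0/ltW//] := eqVneq x 0; rewrite padic_abs0.
Qed.

Lemma padic_absM x y : padic_abs (x * y) = padic_abs x * padic_abs y.
Proof.
have [->|x0] := eqVneq x 0; first by rewrite mul0r padic_abs0 mul0r.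
have [->|y0] := eqVneq y 0; first by rewrite mulr0 padic_abs0 mulr0.
rewrite /padic_abs mulf_eq0 (negbTE x0) (negbTE y0) /=.
case pp : (prime p); last by rewrite !padic_val_np ?pp // oppr0 expr0z mulr1.
have q0 : p%:R != 0 :> rat by rewrite pnatr_eq0 -lt0n prime_gt0.
rewrite -expfzDr // -opprD; congr (_ ^ - _).
rewrite -{1}[x]divq_num_den -{1}[y]divq_num_den mulrACA -invfM -!intrM.
rewrite padic_val_div ?mulf_neq0 ?numq_eq0 ?denq_eq0 // /padic_val.
rewrite !abszM !lognM ?absz_gt0 ?numq_eq0 ?denq_eq0 // !PoszD.
by rewrite opprD addrACA.
Qed.

Lemma padic_abs1 : padic_abs 1 = 1.
Proof.
have := padic_absM 1 1; rewrite mulr1 => /esym/eqP.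
by rewrite -subr_eq0 -{3}[padic_abs 1]mulr1 -mulrBr mulf_eq0 gt_eqF
  ?padic_abs_gt0 //= subr_eq0 => /eqP.
Qed.

Lemma padic_absN x : padic_abs (- x) = padic_abs x.
Proof. by rewrite /padic_abs /padic_val oppr_eq0 numqN denqN abszN. Qed.

Lemma padic_absV x : padic_abs x^-1 = (padic_abs x)^-1.
Proof.
have [->|x0] := eqVneq x 0; first by rewrite !(invr0, padic_abs0).
apply: (mulfI (lt0r_neq0 (padic_abs_gt0 x0))).
by rewrite -padic_absM !divff ?padic_abs1 // lt0r_neq0 ?padic_abs_gt0.
Qed.

Lemma padic_abs_int (a : int) : a != 0 ->
  padic_abs a%:~R = p%:R ^ (- (logn p `|a|)%:Z).
Proof.
move=> a0; rewrite /padic_abs intr_eq0 (negbTE a0); congr (_ ^ - _).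
by rewrite -[a%:~R]divr1 (@padic_val_div a 1) // logn1 subr0.
Qed.

Lemma padic_abs_intD (a b : int) :
  padic_abs (a + b)%:~R <= Num.max (padic_abs a%:~R) (padic_abs b%:~R).
Proof.
have [->|a0] := eqVneq a 0; first by rewrite add0r le_max lexx orbT.
have [->|b0] := eqVneq b 0; first by rewrite addr0 le_max lexx.
have [->|ab0] := eqVneq (a + b) 0.
  by rewrite padic_abs0 le_max padic_abs_ge0.
rewrite !padic_abs_int //.
case pp : (prime p); last first.
  by have np n : logn p n = 0%N by [rewrite lognE pp]; rewrite !np maxxx.
have p1 : 1 <= p%:R :> rat by rewrite ler1n prime_gt0.
have le (m n : nat) : (m <= n)%N -> p%:R ^ (- n%:Z) <= p%:R ^ (- m%:Z) :> rat.
  by move=> mn; rewrite ler_weXz2l // lerN2.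
have dvd m : (m <= logn p `|a|)%N -> (m <= logn p `|b|)%N ->
    (m <= logn p (absz (a + b)%R))%N.
  rewrite -!pfactor_dvdn ?absz_gt0 // => pa pb.
  have : (Posz (p ^ m) %| a + b)%Z by rewrite rpredD // -topredE /= dvdzE absz_nat.
  by rewrite dvdzE absz_nat.
rewrite le_max; case/orP: (leq_total (logn p `|a|) (logn p `|b|)) => H.
  by rewrite le // dvd.
by rewrite orbC le // dvd.
Qed.

Lemma padic_absD x y : padic_abs (x + y) <= Num.max (padic_abs x) (padic_abs y).
Proof.
pose d : rat := (denq x * denq y)%:~R.
have d0 : 0 < padic_abs d.
  by rewrite padic_abs_gt0 // intr_eq0 mulf_neq0 ?denq_eq0.
rewrite -(ler_pM2r d0) (maxr_pMl _ _ (ltW d0)) -!padic_absM mulrDl.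
have -> : x * d = (numq x * denq y)%:~R by rewrite /d !intrM mulrA -numqE.
have -> : y * d = (numq y * denq x)%:~R.
  by rewrite /d mulrC !intrM numqE mulrAC -mulrA mulrC.
by rewrite -intrD; exact: padic_abs_intD.
Qed.

Lemma padic_absB x y : padic_abs (x - y) <= Num.max (padic_abs x) (padic_abs y).
Proof. by rewrite -[padic_abs y]padic_absN padic_absD. Qed.

Lemma padic_abs_distC x y : padic_abs (x - y) = padic_abs (y - x).
Proof. by rewrite -opprB padic_absN. Qed.

Lemma padic_abs_iso x y :
  padic_abs (x - y) < padic_abs x -> padic_abs y = padic_abs x.
Proof.
move=> xy; apply/eqP; rewrite eq_le; apply/andP; split.
  have -> : y = x - (x - y) by rewrite opprB addrC subrK.
  by apply: (le_trans (padic_absB _ _)); rewrite ge_max lexx ltW.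
have := padic_absD (x - y) y; rewrite subrK le_max => /orP[|//].
by rewrite leNgt xy.
Qed.

End PadicAbs.

Definition padic_cauchy (p : nat) : {pred nat -> rat} := fun u =>
  `[< forall e, 0 < e -> exists N, forall m n, (N <= m)%N -> (N <= n)%N ->
        padic_abs p (u m - u n) < e >].

Section CauchyRing.
Variable p : nat.

Lemma padic_cauchy_bounded (u : nat -> rat) : u \in padic_cauchy p ->
  exists2 B, 0 < B & forall n, padic_abs p (u n) <= B.
Proof.
move=> /asboolP/(_ 1 ltr01)[N HN].
pose B := 1 + \sum_(i < N.+1) padic_abs p (u i).
have S0 (i : 'I_N.+1) : padic_abs p (u i) <= \sum_(i < N.+1) padic_abs p (u i).
  by rewrite (bigD1 i) //= lerDl sumr_ge0 // => j _; exact: padic_abs_ge0.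
have SB : \sum_(i < N.+1) padic_abs p (u i) <= B by rewrite lerDr.
exists B; first by rewrite ltr_pwDl // sumr_ge0 // => i _; exact: padic_abs_ge0.
move=> n; have [nN|/ltnW Nn] := leqP n N.
  by apply: le_trans SB; exact: (S0 (Ordinal (nN : (n < N.+1)%N))).
rewrite -(subrK (u N) (u n)); apply: (le_trans (padic_absD _ _ _)).
rewrite ge_max (le_trans (S0 ord_max) SB) andbT.
apply: (le_trans (ltW (HN _ _ Nn (leqnn N)))).
by rewrite lerDl sumr_ge0 // => i _; exact: padic_abs_ge0.
Qed.

Lemma padic_cauchy_subring : subring_closed (padic_cauchy p).
Proof.
split=> [|u v /asboolP Hu /asboolP Hv|u v Hu Hv].
- apply/asboolP => e e0; exists 0%N => m n _ _.
  by rewrite subrr padic_abs0.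
- apply/asboolP => e e0; have [N HN] := Hu e e0; have [N' HN'] := Hv e e0.
  exists (maxn N N') => m n; rewrite !geq_max => /andP[m1 m2] /andP[n1 n2].
  have -> : (u - v) m - (u - v) n = (u m - u n) - (v m - v n).
    by rewrite /= !opprD !opprK !addrA; congr (_ + _); rewrite addrAC.
  by apply: (le_lt_trans (padic_absB _ _ _)); rewrite gt_max HN ?HN'.
- have [A A0 HA] := padic_cauchy_bounded Hu.
  have [B B0 HB] := padic_cauchy_bounded Hv.
  move/asboolP: Hu => Hu; move/asboolP: Hv => Hv.
  apply/asboolP => e e0.
  have [N HN] := Hu _ (divr_gt0 e0 B0); have [N' HN'] := Hv _ (divr_gt0 e0 A0).
  exists (maxn N N') => m n; rewrite !geq_max => /andP[m1 m2] /andP[n1 n2].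
  have -> : (u * v) m - (u * v) n = (u m - u n) * v m + u n * (v m - v n).
    by rewrite /= mulrBl mulrBr addrA subrK.
  apply: (le_lt_trans (padic_absD _ _ _)); rewrite gt_max !padic_absM.
  apply/andP; split.
    apply: (le_lt_trans (ler_wpM2l (padic_abs_ge0 _ _) (HB m))).
    by rewrite -ltr_pdivlMr // HN.
  apply: (le_lt_trans (ler_wpM2r (padic_abs_ge0 _ _) (HA n))).
  by rewrite mulrC -ltr_pdivlMr // HN'.
Qed.

HB.instance Definition _ :=
  GRing.isSubringClosed.Build (nat -> rat) (padic_cauchy p) padic_cauchy_subring.

Record cauchy_seq := CauchySeq {
  cseq :> nat -> rat; cseqP : cseq \in padic_cauchy p }.

HB.instance Definition _ := [isSub for cseq].
HB.instance Definition _ := [Choice of cauchy_seq by <:].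
HB.instance Definition _ := [SubChoice_isSubComNzRing of cauchy_seq by <:].

Definition null_seq : {pred cauchy_seq} := fun u =>
  `[< forall e, 0 < e -> exists N, forall n, (N <= n)%N ->
        padic_abs p (u n) < e >].

Lemma null_seq_ideal : idealr_closed null_seq.
Proof.
split=> [||a u v /asboolP Hu /asboolP Hv].
- by apply/asboolP => e e0; exists 0%N => n _; rewrite padic_abs0.
- apply/asboolP => /(_ 1 ltr01)[N /(_ N (leqnn N))].
  by rewrite padic_abs1 ltxx.
- have [A A0 HA] := padic_cauchy_bounded (cseqP a).
  apply/asboolP => e e0.
  have [N HN] := Hu _ (divr_gt0 e0 A0); have [N' HN'] := Hv _ e0.
  exists (maxn N N') => n; rewrite geq_max => /andP[n1 n2].
  apply: (le_lt_trans (padic_absD _ _ _)); rewrite gt_max HN' // andbT.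
  rewrite padic_absM.
  apply: (le_lt_trans (ler_wpM2r (padic_abs_ge0 _ _) (HA n))).
  by rewrite mulrC -ltr_pdivlMr // HN.
Qed.

HB.instance Definition _ := isIdealr.Build cauchy_seq null_seq null_seq_ideal.

(* Away from the null sequences, the absolute value is eventually constant. *)
Lemma cauchy_abs_stable (u : cauchy_seq) : u \notin null_seq ->
  exists2 r, 0 < r & exists N, forall n, (N <= n)%N -> padic_abs p (u n) = r.
Proof.
move=> /asboolPn/existsNP[e /not_implyP[e0 He]].
have /asboolP/(_ e e0)[N HN] := cseqP u.
have [n Nn un] : exists2 n, (N <= n)%N & e <= padic_abs p (u n).
  apply: contrapT => H; apply: He; exists N => n Nn; rewrite ltNge.
  by apply/negP => un; apply: H; exists n.
exists (padic_abs p (u n)); first exact: lt_le_trans un.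
exists N => m Nm; apply: padic_abs_iso.
by apply: lt_le_trans un; exact: HN.
Qed.

Lemma cauchy_seq_inv (u : cauchy_seq) : u \notin null_seq ->
  exists v : cauchy_seq, v * u - 1 \in null_seq.
Proof.
move=> /cauchy_abs_stable[r r0 [N HN]].
have u0 n : (N <= n)%N -> u n != 0.
  by move=> /HN; apply: contra_eq_neq => ->; rewrite padic_abs0 lt_eqF.
have vP : (fun n => (u n)^-1) \in padic_cauchy p.
  apply/asboolP => e e0; have r2 := mulr_gt0 r0 r0.
  have /asboolP/(_ _ (mulr_gt0 e0 r2))[N' HN'] := cseqP u.
  exists (maxn N N') => m n; rewrite !geq_max => /andP[m1 m2] /andP[n1 n2].
  have -> : (u m)^-1 - (u n)^-1 = (u n - u m) / (u m * u n).
    rewrite invfM mulrBl mulrCA mulfV ?u0 // mulr1 mulrA mulfV ?u0 //.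
    by rewrite mul1r.
  rewrite padic_absM padic_absV padic_absM !HN // ltr_pdivrMr //.
  exact: HN'.
exists (CauchySeq vP); apply/asboolP => e e0; exists N => n Nn.
have -> : (CauchySeq vP * u - 1 : cauchy_seq) n = (u n)^-1 * u n - 1 by [].
by rewrite mulVf ?u0 // subrr padic_abs0.
Qed.

End CauchyRing.

(* The completion of the rationals for the p-adic absolute value: Cauchy
   sequences modulo null sequences. *)
Definition Qp (p : nat) : Type := {ideal_quot (null_seq (p := p))}.

Section QpField.
Variable p : nat.

HB.instance Definition _ := GRing.ComNzRing.on (Qp p).

Definition Qp_of (u : cauchy_seq p) : Qp p :=
  \pi_({ideal_quot (null_seq (p := p))})%qT u.

Definition Qp_rep (x : Qp p) : cauchy_seq p :=
  @repr _ {ideal_quot (null_seq (p := p))} x.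

Lemma Qp_repK x : Qp_of (Qp_rep x) = x.
Proof. exact: reprK. Qed.

Lemma Qp_of_eq (u v : cauchy_seq p) :
  (Qp_of u = Qp_of v) <-> (u - v \in null_seq (p := p)).
Proof.
by rewrite Quotient.idealrBE; split => [/eqP|/eqP].
Qed.

Lemma Qp_ofM (u v : cauchy_seq p) : Qp_of (u * v) = Qp_of u * Qp_of v.
Proof. exact: rmorphM. Qed.

Lemma Qp_ofB (u v : cauchy_seq p) : Qp_of (u - v) = Qp_of u - Qp_of v.
Proof. exact: rmorphB. Qed.

Lemma Qp_of0 : Qp_of 0 = 0.
Proof. exact: rmorph0. Qed.

Lemma Qp_of1 : Qp_of 1 = 1.
Proof. exact: rmorph1. Qed.

Definition Qp_inv (x : Qp p) : Qp p := xget 0 [set y | y * x = 1].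

Lemma Qp_mulVf (x : Qp p) : x != 0 -> Qp_inv x * x = 1.
Proof.
move=> x0; have : Qp_rep x \notin null_seq (p := p).
  apply: contra x0 => x0; apply/eqP; rewrite -[x]Qp_repK -Qp_of0.
  by apply/Qp_of_eq; rewrite subr0.
move=> /cauchy_seq_inv[v /Qp_of_eq]; rewrite Qp_ofM Qp_of1 Qp_repK => vx.
exact: (@xgetPex _ 0 [set y | y * x = 1] (ex_intro _ (Qp_of v) vx)).
Qed.

Lemma Qp_invr0 : Qp_inv 0 = 0.
Proof.
apply: xgetPN => y /= /eqP.
by rewrite mulr0 eq_sym oner_eq0.
Qed.

HB.instance Definition _ :=
  GRing.ComNzRing_isField.Build (Qp p) Qp_mulVf Qp_invr0.

(* The values of [Qp_abs] are rational, so the metric can be taken over [rat];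
   [^o] selects the usual archimedean topology of [rat]. *)
Definition Qp_abs (x : Qp p) : rat :=
  lim ((fun n => padic_abs p (Qp_rep x n) : rat^o) @ \oo).


Lemma padic_abs_lip (x y : rat) :
  `|padic_abs p x - padic_abs p y| <= padic_abs p (x - y).
Proof.
have sub a b : padic_abs p a - padic_abs p b <= padic_abs p (a - b).
  rewrite lerBlDr -{1}(subrK b a); apply: (le_trans (padic_absD _ _ _)).
  by rewrite ge_max lerDl lerDr !padic_abs_ge0.
by rewrite ler_norml sub andbT lerNl opprB padic_abs_distC sub.
Qed.

Lemma null_seqP (u : cauchy_seq p) : u \in null_seq (p := p) <->
  ((fun n => padic_abs p (u n) : rat^o) @ \oo --> (0 : rat^o)).
Proof.
split=> [/asboolP Hu|Hu].
  apply/cvgrPdist_lt => e e0; have [N HN] := Hu e e0.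
  exists N => // n /= Nn; rewrite sub0r normrN ger0_norm ?padic_abs_ge0 //.
  exact: HN.
apply/asboolP => e e0; have /cvgrPdist_lt/(_ e e0)[N _ HN] := Hu.
exists N => n Nn; have := HN n Nn; rewrite /= sub0r normrN ger0_norm //.
exact: padic_abs_ge0.
Qed.

Lemma padic_abs_cvg (u : cauchy_seq p) :
  cvg ((fun n => padic_abs p (u n) : rat^o) @ \oo).
Proof.
have [/null_seqP H|] := boolP (u \in null_seq (p := p)).
  by apply/cvg_ex; exists 0.
move=> /cauchy_abs_stable[r r0 [N HN]]; apply/cvg_ex; exists r.
apply/cvgrPdist_lt => e e0; exists N => // n /= Nn.
by rewrite HN // subrr normr0.
Qed.

Lemma Qp_abs_of (u : cauchy_seq p) :
  (fun n => padic_abs p (u n) : rat^o) @ \oo --> (Qp_abs (Qp_of u) : rat^o).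
Proof.
set w := Qp_rep (Qp_of u).
have /null_seqP uw : w - u \in null_seq (p := p).
  by apply/Qp_of_eq; rewrite Qp_repK.
have cw := @padic_abs_cvg w.
apply/cvgrPdist_lt => e e0.
have e2 : 0 < e / 2 by rewrite divr_gt0.
have /cvgrPdist_lt/(_ _ e2)[N _ HN] := cw.
have /cvgrPdist_lt/(_ _ e2)[N' _ HN'] := uw.
exists (maxn N N') => // n /=; rewrite geq_max => /andP[n1 n2].
have := HN' n n2; rewrite /= sub0r normrN ger0_norm ?padic_abs_ge0 // => H.
rewrite -(subrK (padic_abs p (w n)) (Qp_abs _)) -addrA.
apply: (le_lt_trans (ler_normD _ _)); rewrite [ltRHS]splitr.
apply: ltrD; first exact: HN.
by apply: (le_lt_trans (padic_abs_lip _ _)); exact: H.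
Qed.

Lemma Qp_abs_unique (u : cauchy_seq p) (l : rat) :
  (fun n => padic_abs p (u n) : rat^o) @ \oo --> (l : rat^o) ->
  Qp_abs (Qp_of u) = l.
Proof. by move=> Hl; apply: (cvg_unique _ (@Qp_abs_of u) Hl). Qed.

Lemma Qp_abs0 : Qp_abs 0 = 0.
Proof.
by rewrite -Qp_of0; apply: Qp_abs_unique; apply/null_seqP; exact: rpred0.
Qed.

Lemma Qp_abs0_eq0 (x : Qp p) : Qp_abs x = 0 -> x = 0.
Proof.
rewrite -[x]Qp_repK => x0; rewrite -Qp_of0; apply/Qp_of_eq; rewrite subr0.
by apply/null_seqP; rewrite -[in X in _ --> X]x0; exact: Qp_abs_of.
Qed.

Lemma Qp_absM (x y : Qp p) : Qp_abs (x * y) = Qp_abs x * Qp_abs y.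
Proof.
rewrite -[x]Qp_repK -[y]Qp_repK -Qp_ofM; apply: Qp_abs_unique.
under eq_fun do rewrite /= padic_absM.
exact: cvgM (@Qp_abs_of _) (@Qp_abs_of _).
Qed.

Lemma Qp_absN (x : Qp p) : Qp_abs (- x) = Qp_abs x.
Proof.
rewrite -[x]Qp_repK -[- _]sub0r -Qp_of0 -Qp_ofB; apply: Qp_abs_unique.
under eq_fun do rewrite /= sub0r padic_absN.
exact: Qp_abs_of.
Qed.

Lemma Qp_abs_triangle (x y : Qp p) : Qp_abs (x - y) <= Qp_abs x + Qp_abs y.
Proof.
rewrite -[x]Qp_repK -[y]Qp_repK -Qp_ofB.
apply: (ler_cvg_to (@Qp_abs_of _) (cvgD (@Qp_abs_of _) (@Qp_abs_of _))).
apply: nearW => n /=; apply: (le_trans (padic_absB _ _ _)).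
by rewrite ge_max lerDl lerDr !padic_abs_ge0.
Qed.

Definition Qp_dist (x y : Qp p) : rat := Qp_abs (x - y).

Lemma Qp_distxx x : Qp_dist x x = 0.
Proof. by rewrite /Qp_dist subrr Qp_abs0. Qed.

Lemma Qp_dist_eq0 x y : Qp_dist x y = 0 -> x = y.
Proof. by move/Qp_abs0_eq0/eqP; rewrite subr_eq0 => /eqP. Qed.

Lemma Qp_distC x y : Qp_dist x y = Qp_dist y x.
Proof. by rewrite /Qp_dist -opprB Qp_absN. Qed.

Lemma Qp_dist_triangle y x z : Qp_dist x z <= Qp_dist x y + Qp_dist y z.
Proof.
rewrite (Qp_distC y z); apply: le_trans (Qp_abs_triangle _ _).
by rewrite opprB addrA subrK.
Qed.

HB.instance Definition _ := isMetric.Build rat (Qp p)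
  Qp_distxx Qp_dist_eq0 Qp_distC Qp_dist_triangle.

End QpField.

(* [Some x] is the point x of Q_p and [None] the point at infinity. *)
Definition P1Qp (p : nat) : Type := one_point_compactification (Qp p).

HB.instance Definition _ (p : nat) := Topological.on (P1Qp p).

Definition P1_infty (p : nat) : P1Qp p := None.

Definition mobius (p : nat) (a b c d : Qp p) (z : P1Qp p) : P1Qp p :=
  match z with
  | Some x => if c * x + d == 0 then P1_infty p
              else Some ((a * x + b) / (c * x + d))
  | None => if c == 0 then P1_infty p else Some (a / c)
  end.

Section Dynamics.
Context {T : topologicalType}.
Variable f : T -> T.

Definition forward_orbit (x : T) : set T := [set iter n f x | n in [set: nat]].

Definition subsystem (E : set T) : Prop := compact E /\ f @` E `<=` E.

Definition minimal_subsystem (E : set T) : Prop :=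
  subsystem E /\ forall x, E x -> E = closure (forward_orbit x).

Definition minimal_decomposition (M : nat) (F : 'I_M -> set T) : Prop :=
  [/\ \bigcup_i F i = [set: T],
      trivIset [set: 'I_M] F &
      forall i, F i !=set0 /\ minimal_subsystem (F i)].

Definition conjugate_subsystems (E E' : set T) : Prop :=
  exists h k : T -> T,
    [/\ {within E, continuous h} /\ {within E', continuous k},
        (forall x, E x -> E' (h x)) /\ (forall y, E' y -> E (k y)),
        (forall x, E x -> k (h x) = x) /\ (forall y, E' y -> h (k y) = y) &
        forall x, E x -> h (f x) = f (h x)].

End Dynamics.

(* Main.v *)
Require Import Defs.
From mathcomp Require Import all_boot all_order all_algebra.
From mathcomp Require Import all_classical reals topology normedtype sequences.
From mathcomp Require Import ring.

(* Let t = a + d and D = Delta / t^2, which is not a square because phi has no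
   fixed point. An explicit Moebius map conjugates phi to
   s |-> (s + 1) / (D s + 1), that is, to the multiplication by 1 + sqrt(D) on
   Q_p(sqrt D)^* / Q_p^* = P^1(Q_p). The group acts simply transitively and
   commutes with phi, so all orbit closures are translates of each other. By
   compactness some iterate of phi is the translation by a small r <> 0, and
   base-p digits show that its multiples are dense in the ball |y| <= |r|. Hence
   every orbit closure is open, orbit closures partition the line, and there are
   finitely many of them. Since lambda determines D, it determines phi up to
   conjugacy. *)

Import Order.TTheory GRing.Theory Num.Theory.
Import numFieldNormedType.Exports.
Set Implicit Arguments.
Unset Strict Implicit.
Unset Printing Implicit Defensive.
Local Open Scope classical_set_scope.
Local Open Scope ring_scope.

(** * Orbit closures of homogeneous systems *)

Lemma closure_continuous {S T : topologicalType} (g : S -> T) (A : set S)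
    (B : set T) x :
  {for x, continuous g} -> (forall y, A y -> B (g y)) ->
  closure A x -> closure B (g x).
Proof.
move=> cg AB Ax U /cg /Ax[y [Ay Uy]].
by exists (g y); split => //; exact: AB.
Qed.

Lemma continuous_iter {T : topologicalType} (f : T -> T) n :
  continuous f -> continuous (iter n f).
Proof.
move=> cf; elim: n => [|n IH] x; first exact: cvg_id.
by apply: (@continuous_comp _ _ _ (iter n f) f); [exact: IH|exact: cf].
Qed.

Lemma iter_morph {S T : Type} (f : S -> S) (g : T -> T) (h : S -> T) :
  (forall z, h (f z) = g (h z)) ->
  forall n z, h (iter n f z) = iter n g (h z).
Proof. by move=> hfg; elim=> [//|n IH] z; rewrite !iterS hfg IH. Qed.

Section OrbitClosures.
Context {T : topologicalType}.
Variable f : T -> T.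
Hypothesis cf : continuous f.

Definition orbit_closure (x : T) : set T := closure (forward_orbit f x).

Lemma mem_orbit_closure x : orbit_closure x x.
Proof. by apply: subset_closure; exists 0%N. Qed.

Lemma orbit_closure_iter n x y :
  orbit_closure x y -> orbit_closure x (iter n f y).
Proof.
apply: closure_continuous; first exact: continuous_iter.
by move=> _ [m _ <-]; exists (n + m)%N => //; rewrite iterD.
Qed.

Lemma orbit_closure_trans x y :
  orbit_closure x y -> orbit_closure y `<=` orbit_closure x.
Proof.
move=> xy; rewrite [X in _ `<=` X](closure_id _).1; last exact: closed_closure.
by apply: closureS => _ [n _ <-]; exact: orbit_closure_iter.
Qed.

(** The centralizer of [f] among the homeomorphisms of [T] acts transitively. *)
Definition homogeneous := forall x y : T, exists g g' : T -> T,
  [/\ continuous g, continuous g', cancel g g' /\ cancel g' g,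
      forall z, g (f z) = f (g z) & g x = y].

Hypothesis hf : homogeneous.

(** By minimality [E] and [E'] are the orbit closures of [x] and [y]; a homeomorphism that commutes
    with [f] and sends [x] to [y] matches them. *)
Lemma minimal_conjugate (E E' : set T) :
  minimal_subsystem f E -> minimal_subsystem f E' -> E !=set0 -> E' !=set0 ->
  conjugate_subsystems f E E'.
Proof.
move=> [_ mE] [_ mE'] [x Ex] [y E'y].
have [g [g' [cg cg' [gK g'K] gf gx]]] := hf x y.
have g'f z : g' (f z) = f (g' z) by rewrite -{1}(g'K z) -gf gK.
have g'y : g' y = x by rewrite -gx gK.
rewrite (mE _ Ex) (mE' _ E'y); exists g, g'; split=> //.
- by split; apply: continuous_subspaceT.
- split=> z.
    apply: closure_continuous; first exact: cg.
    by move=> _ [n _ <-]; exists n => //; rewrite (iter_morph gf) gx.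
  apply: closure_continuous; first exact: cg'.
  by move=> _ [n _ <-]; exists n => //; rewrite (iter_morph g'f) g'y.
Qed.

Variable x0 : T.
Hypothesis nbhs_x0 : nbhs x0 (orbit_closure x0).
Hypothesis rec_x0 : forall N, orbit_closure (iter N f x0) x0.

Lemma orbit_closure_nbhs x : nbhs x (orbit_closure x).
Proof.
have [g [g' [cg cg' [gK g'K] gf gx]]] := hf x0 x.
have : nbhs x (g' @^-1` orbit_closure x0).
  by apply: cg'; rewrite -gx gK.
apply: filterS => z /= /closure_continuous -/(_ _ g (forward_orbit f x) (@cg _)).
rewrite g'K; apply => _ [n _ <-].
by exists n => //; rewrite (iter_morph gf) gx.
Qed.

Lemma orbit_closure_rec N x : orbit_closure (iter N f x) x.
Proof.
have [g [g' [cg cg' [gK g'K] gf gx]]] := hf x0 x.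
have := rec_x0 N => /closure_continuous -/(_ _ g _ (@cg _)).
rewrite gx; apply => _ [n _ <-].
by exists n => //; rewrite !(iter_morph gf) gx.
Qed.

(** The orbit of [x] enters [orbit_closure y], a neighbourhood of [y], at some iterate of [x]; by
    recurrence the orbit closure of this iterate contains [x]. *)
Lemma orbit_closure_sym x y : orbit_closure x y -> orbit_closure y x.
Proof.
move=> /(_ _ (orbit_closure_nbhs y)) [_ [[n _ <-]] yn].
by apply: (orbit_closure_trans yn); exact: orbit_closure_rec.
Qed.

Lemma orbit_closure_eq x y :
  orbit_closure x y -> orbit_closure x = orbit_closure y.
Proof.
move=> xy; apply/seteqP; split; apply: orbit_closure_trans => //.
exact: orbit_closure_sym.
Qed.

Hypothesis cT : compact [set: T].

(** If no finite union of orbit closures is everything, their complements generate a proper filter.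
    It clusters at some [z], but [orbit_closure z] is a neighbourhood of [z] whose complement lies
    in the filter. *)
Lemma orbit_closure_cover :
  exists s : seq T, forall x, exists2 y, y \in s & orbit_closure y x.
Proof.
pose C (s : seq T) : set T := [set x | exists2 y, y \in s & orbit_closure y x].
apply: contrapT => nC.
pose F : set_system T := [set A | exists s, ~` C s `<=` A].
have FF : ProperFilter F.
  split.
    move=> [s Cs]; apply: nC; exists s => x.
    by apply: contrapT => nCx; exact: (Cs x).
  split; first by exists [::].
    move=> P Q [s Ps] [t Qt]; exists (s ++ t) => x Cx.
    by split; [apply: Ps|apply: Qt] => -[y ys yx]; apply: Cx; exists y;
      rewrite // mem_cat ys ?orbT.
  by move=> P Q PQ [s Ps]; exists s => x /Ps/PQ.
have [|z [_ zF]] := cT FF; first by exists [::].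
have Fz : F (~` C [:: z]) by exists [:: z].
have [x [Cx zx]] := zF _ _ Fz (orbit_closure_nbhs z).
by apply: Cx; exists z => //; rewrite inE.
Qed.

Lemma minimal_decomposition_exists :
  exists (M : nat) (F : 'I_M -> set T), minimal_decomposition f F.
Proof.
have [s sP] := orbit_closure_cover.
(* Different points may have the same orbit closure; since orbit closures that meet are equal,
   removing repetitions makes the family disjoint. *)
pose t := undup [seq orbit_closure x | x <- s].
have tE i : (i < size t)%N -> exists x, nth set0 t i = orbit_closure x.
  by move=> /(mem_nth set0); rewrite mem_undup => /mapP[x _ ->]; exists x.
exists (size t), (fun i => nth set0 t i); split.
- apply/seteqP; split=> // x _; have [y ys yx] := sP x.
  have yt : orbit_closure y \in t by rewrite mem_undup map_f.
  rewrite -index_mem in yt; exists (Ordinal yt) => //=.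
  by rewrite nth_index // -index_mem.
- move=> i j _ _ [z []].
  have [x xi] := tE i (ltn_ord i); rewrite xi => /orbit_closure_eq xz.
  have [y yj] := tE j (ltn_ord j); rewrite yj => /orbit_closure_eq yz.
  apply/val_inj/eqP; rewrite -(@nth_uniq _ set0 t) ?ltn_ord ?undup_uniq //.
  by rewrite xi yj xz yz.
- move=> i; have [x ->] := tE i (ltn_ord i).
  split; first by exists x; exact: mem_orbit_closure.
  split; last by move=> y /orbit_closure_eq ->.
  split; last by move=> _ [y xy <-]; exact: (@orbit_closure_iter 1).
  by apply: subclosed_compact cT _ => //; exact: closed_closure.
Qed.

End OrbitClosures.

(** * Uniqueness of the decomposition and transport along a conjugacy *)

Section Transfer.
Context {T : topologicalType}.

Lemma minimal_subsystem_inj (f : T -> T) (E E' : set T) z :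
  minimal_subsystem f E -> minimal_subsystem f E' -> E z -> E' z -> E = E'.
Proof. by move=> [_ mE] [_ mE'] /mE -> /mE' ->. Qed.

(** Minimal subsystems that meet coincide, so every [F i] is some [F' j]; disjointness and
    nonemptiness make the choice of [j] injective in [i]. *)
Lemma minimal_decomposition_leq (f : T -> T) M M' (F : 'I_M -> set T)
    (F' : 'I_M' -> set T) :
  minimal_decomposition f F -> minimal_decomposition f F' -> (M <= M')%N.
Proof.
move=> [_ tF mF] [cF' _ mF'].
have /choice[g gE] i : exists j, F i = F' j.
  have [[x Fx] mFi] := mF i.
  have : [set: T] x by []; rewrite -cF' => -[j _ F'x]; exists j.
  exact: (minimal_subsystem_inj mFi (mF' j).2 Fx F'x).
rewrite -[leqLHS]card_ord -[leqRHS]card_ord; apply: (@leq_card _ _ g).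
move=> i j gij; have [[x Fx] _] := mF i.
by apply: tF => //; exists x; split => //; rewrite gE -gij -gE.
Qed.

Lemma minimal_decomposition_unique (f : T -> T) M M' (F : 'I_M -> set T)
    (F' : 'I_M' -> set T) :
  minimal_decomposition f F -> minimal_decomposition f F' -> M = M'.
Proof.
move=> dF dF'; apply/eqP; rewrite eqn_leq.
by rewrite (minimal_decomposition_leq dF dF') (minimal_decomposition_leq dF' dF).
Qed.

Variables (f g h k : T -> T).
Hypotheses (ch : continuous h) (ck : continuous k).
Hypotheses (hK : cancel h k) (kK : cancel k h).
Hypothesis hfg : forall z, h (f z) = g (h z).

Lemma conjugate_sym z : k (g z) = f (k z).
Proof. by rewrite -{1}(kK z) -hfg hK. Qed.

Lemma homogeneous_conjugate : homogeneous f -> homogeneous g.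
Proof.
move=> hf x y; have [u [u' [cu cu' [uK u'K] uf ux]]] := hf (k x) (k y).
have c3 v : continuous v -> continuous (h \o v \o k).
  move=> cv z; apply: continuous_comp; first exact: ck.
  by apply: continuous_comp; [exact: cv|exact: ch].
exists (h \o u \o k), (h \o u' \o k); split; [exact: c3|exact: c3| | |].
- by split=> z /=; rewrite hK ?uK ?u'K kK.
- by move=> z /=; rewrite conjugate_sym uf hfg.
- by rewrite /= ux kK.
Qed.

Lemma minimal_decomposition_conjugate M (F : 'I_M -> set T) :
  minimal_decomposition f F -> minimal_decomposition g (fun i => h @` F i).
Proof.
move=> [cF tF mF]; split.
- apply/seteqP; split => // y _; have : [set: T] (k y) by [].
  by rewrite -cF => -[i _ Fi]; exists i => //; exists (k y).
- move=> i j _ _ [_ [[x Fx <-] [y Fy /(can_inj hK) yx]]].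
  by apply: tF => //; exists x; split => //; rewrite -yx.
- move=> i; have [[x Fx] [[cFi fF] mFi]] := mF i.
  split; first by exists (h x); exists x.
  split; first split.
  + by apply: continuous_compact cFi; apply: continuous_subspaceT.
  + move=> _ [_ [y Fy <-] <-]; exists (f y) => //.
    by apply: fF; exists y.
  + move=> _ [y Fy <-]; rewrite {1}(mFi y Fy); apply/seteqP; split.
      move=> _ [z yz <-]; apply: closure_continuous yz; first exact: ch.
      by move=> _ [n _ <-]; exists n => //; rewrite (iter_morph hfg).
    move=> z yz; exists (k z) => //.
    apply: closure_continuous yz; first exact: ck.
    move=> _ [n _ <-]; exists n => //.
    by rewrite (iter_morph conjugate_sym) hK.
Qed.

End Transfer.

(** * The absolute value of Q_p *)

Section QpAbs.
Variable p : nat.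
Implicit Types (x y : Qp p) (u : cauchy_seq p).

Lemma Qp_abs_ge0 x : 0 <= Qp_abs x.
Proof.
have := Qp_abs_triangle x x.
by rewrite subrr Qp_abs0 -mulr2n pmulrn_lge0.
Qed.

Lemma Qp_abs_eq0 x : (Qp_abs x == 0) = (x == 0).
Proof. by apply/eqP/eqP => [/Qp_abs0_eq0|->]//; exact: Qp_abs0. Qed.

Lemma Qp_abs_gt0 x : (0 < Qp_abs x) = (x != 0).
Proof. by rewrite lt_def Qp_abs_eq0 Qp_abs_ge0 andbT. Qed.

Lemma Qp_abs_lt_near u e : Qp_abs (Qp_of u) < e ->
  exists N, forall n, (N <= n)%N -> padic_abs p (u n) < e.
Proof.
rewrite -subr_gt0 => e0; have /cvgrPdist_lt/(_ _ e0)[N _ HN] := @Qp_abs_of _ u.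
exists N => n /HN /=; rewrite distrC => /ltr_normlW.
by rewrite ltrBlDr subrK.
Qed.

Lemma Qp_abs_le_near u e N :
  (forall n, (N <= n)%N -> padic_abs p (u n) <= e) -> Qp_abs (Qp_of u) <= e.
Proof.
move=> H; apply: (ler_cvg_to (@Qp_abs_of _ u) (@cvg_cst rat^o e _ _ _)).
by exists N.
Qed.

(** The ultrametric inequality is inherited from the rationals: for each [d > 0], representatives of
    [x] and [y] are eventually below [e + d]. A common bound [e] replaces the maximum. *)
Lemma Qp_absD_le x y e : Qp_abs x <= e -> Qp_abs y <= e -> Qp_abs (x + y) <= e.
Proof.
move=> xe ye; apply/ler_addgt0Pr => d d0.
have eed : e < e + d by rewrite ltrDl.
move: xe ye; rewrite -[x]Qp_repK -[y]Qp_repK.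
move=> /le_lt_trans -/(_ _ eed)/Qp_abs_lt_near[N HN].
move=> /le_lt_trans -/(_ _ eed)/Qp_abs_lt_near[N' HN'].
rewrite /Qp_of -rmorphD; apply: (@Qp_abs_le_near _ _ (maxn N N')) => n.
rewrite geq_max => /andP[/HN Nn /HN' N'n].
by apply: (le_trans (padic_absD _ _ _)); rewrite ge_max !ltW.
Qed.

Lemma Qp_absB_le x y e : Qp_abs x <= e -> Qp_abs y <= e -> Qp_abs (x - y) <= e.
Proof. by move=> xe ye; apply: Qp_absD_le; rewrite ?Qp_absN. Qed.

Lemma Qp_absB_lt x y e : Qp_abs x < e -> Qp_abs y < e -> Qp_abs (x - y) < e.
Proof.
move=> xe ye; apply: (@le_lt_trans _ _ (Num.max (Qp_abs x) (Qp_abs y))).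
  by apply: Qp_absB_le; rewrite le_max lexx ?orbT.
by rewrite gt_max xe.
Qed.

Lemma Qp_abs_iso x y : Qp_abs (x - y) < Qp_abs x -> Qp_abs y = Qp_abs x.
Proof.
move=> xy; apply/eqP; rewrite eq_le; apply/andP; split.
  by rewrite -[y](subKr x) Qp_absB_le // ltW.
rewrite leNgt; apply/negP => yx.
suff : Qp_abs x < Qp_abs x by rewrite ltxx.
by rewrite -{1}[x](subrK y) -[y in _ + y]opprK Qp_absB_lt ?Qp_absN.
Qed.

Lemma Qp_abs1 : Qp_abs (1 : Qp p) = 1.
Proof.
have : Qp_abs (1 : Qp p) != 0 by rewrite Qp_abs_eq0 oner_eq0.
by move=> /mulfI; apply; rewrite -Qp_absM !mulr1.
Qed.

Lemma Qp_absV x : Qp_abs x^-1 = (Qp_abs x)^-1.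
Proof.
have [->|x0] := eqVneq x 0; first by rewrite !(invr0, Qp_abs0).
have xn0 : Qp_abs x != 0 by rewrite Qp_abs_eq0.
by apply: (mulfI xn0); rewrite -Qp_absM !divff ?Qp_abs1.
Qed.

Lemma Qp_absX x n : Qp_abs (x ^+ n) = Qp_abs x ^+ n.
Proof. by elim: n => [|n IH]; rewrite ?Qp_abs1 // !exprS Qp_absM IH. Qed.

Lemma Qp_ballE x e : ball x e = [set y | Qp_abs (x - y) < e].
Proof. by []. Qed.

Lemma cauchy_seq_natE k n : (k%:R : cauchy_seq p) n = k%:R.
Proof. by elim: k => [//|k IH]; rewrite -!natr1 -IH. Qed.

Lemma Qp_of_nat k : Qp_of (k%:R : cauchy_seq p) = k%:R.
Proof. exact: rmorph_nat. Qed.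

Lemma Qp_abs_natB k l :
  Qp_abs (k%:R - l%:R : Qp p) = padic_abs p (k%:R - l%:R).
Proof.
rewrite -!Qp_of_nat -Qp_ofB; apply: Qp_abs_unique.
under eq_fun => n.
  have -> : (k%:R - l%:R : cauchy_seq p) n = k%:R - l%:R.
    by rewrite -(cauchy_seq_natE k n) -(cauchy_seq_natE l n).
  over.
exact: cvg_cst.
Qed.

Lemma Qp_abs_nat k : Qp_abs (k%:R : Qp p) = padic_abs p k%:R.
Proof.
by have := Qp_abs_natB k 0; rewrite !subr0.
Qed.

Lemma Qp_nat_eq0 k : ((k%:R : Qp p) == 0) = (k == 0%N).
Proof.
rewrite -Qp_abs_eq0 Qp_abs_nat.
by case: (eqVneq k 0%N) => [->|k0]; rewrite ?padic_abs0 //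
  gt_eqF ?padic_abs_gt0 ?pnatr_eq0.
Qed.

Lemma Qp_abs_nat_le1 k : Qp_abs (k%:R : Qp p) <= 1.
Proof.
elim: k => [|k IH]; first by rewrite Qp_abs0.
by rewrite -natr1 Qp_absD_le ?Qp_abs1.
Qed.
End QpAbs.

(** * Base-p digits and compactness of the unit ball *)

Section QpPrime.
Variable p : nat.
Hypothesis hp : prime p.
Implicit Types (x y : Qp p) (u : cauchy_seq p).

Let p_gt0 : 0 < p%:R :> rat. Proof. by rewrite ltr0n prime_gt0. Qed.
Let p_gt1 : 1 < p%:R :> rat. Proof. by rewrite ltr1n prime_gt1. Qed.

Lemma padic_abs_p : padic_abs p p%:R = p%:R^-1.
Proof.
have := @padic_abs_int p p.
by rewrite /= logn_prime // eqxx exprN1; apply; case: (p) hp.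
Qed.

Lemma Qp_abs_p : Qp_abs (p%:R : Qp p) = p%:R^-1.
Proof. by rewrite Qp_abs_nat padic_abs_p. Qed.

Lemma padic_abs_int_le1 (a : int) : padic_abs p a%:~R <= 1.
Proof.
have [->|a0] := eqVneq a 0; first by rewrite padic_abs0.
by rewrite padic_abs_int // -exprnN invr_le1 ?unitfE ?gt_eqF ?exprn_gt0 //
  exprn_ege1 // ltW.
Qed.

Lemma padic_abs_int_dvd (a : int) : (p %| a)%Z -> padic_abs p a%:~R <= p%:R^-1.
Proof.
move=> /dvdzP[b ->]; rewrite intrM padic_absM padic_abs_p.
by rewrite ler_piMl ?invr_ge0 ?(ltW p_gt0) // padic_abs_int_le1.
Qed.

Lemma padic_abs_coprime (a : int) : ~~ (p %| a)%Z -> padic_abs p a%:~R = 1.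
Proof.
move=> pa; have a0 : a != 0 by apply: contraNneq pa => ->; rewrite dvdz0.
rewrite padic_abs_int //; suff -> : logn p `|a| = 0%N by rewrite oppr0 expr0z.
by apply/eqP; rewrite -leqn0 leqNgt logn_gt0 mem_primes hp absz_gt0 a0.
Qed.

(* If |q| < p then p does not divide the denominator of q, so the digit is the
   numerator times an inverse of the denominator modulo p. *)
Lemma padic_digit (q : rat) : padic_abs p q < p%:R ->
  exists2 j, (j < p)%N & padic_abs p (q - j%:R) <= p%:R^-1.
Proof.
move=> q1; set d := denq q; set n := numq q.
have qE : q = n%:~R / d%:~R by rewrite divq_num_den.
have d0 : d%:~R != 0 :> rat by rewrite intr_eq0 denq_eq0.
have dp : ~~ (p %| d)%Z.
  apply/negP => pd; have pn : ~~ (p %| n)%Z.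
    apply/negP => pn; have := coprime_num_den q.
    rewrite /coprime => /eqP ndq.
    have : (p %| gcdn `|n| `|d|)%N by rewrite dvdn_gcd; apply/andP.
    by rewrite ndq Euclid_dvd1.
  have : padic_abs p n%:~R < 1.
    have -> : n%:~R = q * d%:~R by rewrite {1}qE divfK.
    rewrite padic_absM -[ltRHS](mulfV (lt0r_neq0 p_gt0)).
    apply: (le_lt_trans (ler_wpM2l (padic_abs_ge0 _ _) (padic_abs_int_dvd pd))).
    by rewrite ltr_pM2r // invr_gt0.
  by rewrite padic_abs_coprime // ltxx.
have /coprimezP[[v w] /= vw1] : coprimez d p.
  by rewrite coprimezE coprime_sym prime_coprime.
have p0 : (p : int) != 0 by rewrite eqz_nat -lt0n prime_gt0.
have j0 := modz_ge0 (n * v) p0.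
exists `|(n * v %% p)%Z|%N.
  by rewrite -ltz_nat gez0_abs // ltz_pmod // ltz_nat prime_gt0.
have -> : q - `|(n * v %% p)%Z|%:R = (p%:Z * (n * w + (n * v %/ p)%Z * d))%:~R / d%:~R.
  have -> : `|(n * v %% p)%Z|%:R = (n * v %% p)%Z%:~R :> rat.
    by rewrite -{2}(gez0_abs j0).
  rewrite {1}qE -[X in _ - X](mulfK d0) -mulrBl -!intrM -intrB; congr (_%:~R / _).
  have {1}-> : n = n * v * d + n * w * p by rewrite -!mulrA -mulrDr vw1 mulr1.
  rewrite {1}(divz_eq (n * v) p); ring.
rewrite padic_absM padic_absV (padic_abs_coprime dp) invr1 mulr1.
by rewrite padic_abs_int_dvd // dvdz_mulr.
Qed.

Lemma Qp_digit x : Qp_abs x <= 1 ->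
  exists2 j, (j < p)%N & Qp_abs (x - j%:R) <= p%:R^-1.
Proof.
rewrite -[x]Qp_repK; set u := Qp_rep x => x1.
have /asboolP/(_ p%:R^-1)[|N HN] := cseqP u; first by rewrite invr_gt0.
(* Strict bounds pass from the limit to the terms, so [|x| <= 1] is weakened to [|x| < p], the form
   that [padic_digit] expects. *)
have [N' HN'] := Qp_abs_lt_near (le_lt_trans x1 p_gt1).
pose M := maxn N N'.
have [j jp uj] := padic_digit (HN' M (leq_maxr _ _)).
exists j => //; rewrite -Qp_of_nat -Qp_ofB; apply: (@Qp_abs_le_near _ _ _ N) => n Nn.
have -> : (u - j%:R) n = (u n - u M) + (u M - j%:R).
  by rewrite addrA subrK -(cauchy_seq_natE p j n).
apply: (le_trans (padic_absD _ _ _)); rewrite ge_max uj andbT.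
by rewrite ltW // HN // leq_maxl.
Qed.

(** Horner's scheme: [i] is the lowest digit of [x], and the induction hypothesis applies to
    [(x - i) / p], which is again in the unit ball. *)
Lemma Qp_residue k x : Qp_abs x <= 1 ->
  exists2 j, (j < p ^ k)%N & Qp_abs (x - j%:R) <= p%:R^-1 ^+ k.
Proof.
elim: k x => [|k IH] x x1; first by exists 0%N => //; rewrite subr0 expr0.
have [i ip xi] := Qp_digit x1.
have p0 : p%:R != 0 :> Qp p by rewrite Qp_nat_eq0 -lt0n prime_gt0.
have [|j jp xj] := IH ((x - i%:R) / p%:R).
  by rewrite Qp_absM Qp_absV Qp_abs_p invrK -ler_pdivlMr // div1r.
exists (i + p * j)%N.
  apply: (@leq_trans (p + p * j)); first by rewrite ltn_add2r.
  by rewrite -mulnS expnS leq_mul.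
have -> : x - (i + p * j)%:R = p%:R * ((x - i%:R) / p%:R - j%:R).
  by rewrite natrD natrM mulrBr mulrCA divff // mulr1 opprD addrA.
by rewrite Qp_absM Qp_abs_p exprS ler_pM2l ?invr_gt0.
Qed.

Lemma rat_expr_lt (e : rat) : 0 < e -> exists k, p%:R^-1 ^+ k < e.
Proof.
move=> e0; exists (Num.bound e^-1).
rewrite exprVn invf_plt ?posrE ?exprn_gt0 //.
apply: (lt_trans (archi_boundP (ltW _))); first by rewrite invr_gt0.
by rewrite -natrX ltr_nat ltn_expl // prime_gt1.
Qed.

Lemma ultra_bigcup {T} (F : set_system T) (A : nat -> set T) N :
  UltraFilter F -> F [set x | exists2 j, (j < N)%N & A j x] -> exists j, F (A j).
Proof.
move=> FU; have FF : ProperFilter F := @ultra_proper _ _ FU.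
elim: N => [|N IH] FA.
  by exfalso; apply: (@filter_not_empty _ F); apply: filterS FA => x [].
have [/IH//|FAC] := in_ultra_setVsetC [set x | exists2 j, (j < N)%N & A j x] FU.
exists N; apply: filterS2 FA FAC => x [j jN Ajx] nA.
move: jN; rewrite ltnS leq_eqVlt => /orP[/eqP <- //|jN].
by exfalso; apply: nA; exists j.
Qed.

(** For each [k] an ultrafilter on the ball selects one of the finitely many residues modulo
    [p ^ k]; the selected integers [a k] form a Cauchy sequence, whose class is the limit. *)
Lemma unit_ball_compact : compact [set x : Qp p | Qp_abs x <= 1].
Proof.
rewrite compact_ultra => F FU F1.
have FF : ProperFilter F := @ultra_proper _ _ FU.
have /choice[a aP] k : exists j : nat, F [set x | Qp_abs (x - j%:R) <= p%:R^-1 ^+ k].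
  apply: (@ultra_bigcup _ F
    (fun j => [set x : Qp p | Qp_abs (x - j%:R) <= p%:R^-1 ^+ k]) (p ^ k)).
  by apply: filterS F1 => x /(Qp_residue k).
have aC k l : (k <= l)%N -> Qp_abs ((a k)%:R - (a l)%:R : Qp p) <= p%:R^-1 ^+ k.
  move=> kl; have [x /= [xk xl]] := filter_ex (filterI (aP k) (aP l)).
  have -> : (a k)%:R - (a l)%:R = (x - (a l)%:R) - (x - (a k)%:R).
    by rewrite opprB [RHS]addrC addrA subrK.
  rewrite Qp_absB_le // (le_trans xl) // ler_wiXn2l // ?invr_ge0 ?ltW //.
  by rewrite invf_lt1.
have aC' k l : (k <= l)%N -> padic_abs p ((a k)%:R - (a l)%:R) <= p%:R^-1 ^+ k.
  by rewrite -Qp_abs_natB; exact: aC.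
have aP' : (fun k => (a k)%:R) \in padic_cauchy p.
  apply/asboolP => e /rat_expr_lt[N Ne]; exists N => m n Nm Nn.
  apply: le_lt_trans Ne; rewrite -(subrK (a N)%:R (a m)%:R) -addrA.
  apply: (le_trans (padic_absD _ _ _)); rewrite ge_max aC' // andbT.
  by rewrite padic_abs_distC aC'.
set x := Qp_of (CauchySeq aP').
have xa k : Qp_abs (x - (a k)%:R) <= p%:R^-1 ^+ k.
  rewrite -Qp_of_nat -Qp_ofB; apply: (@Qp_abs_le_near _ _ _ k) => n kn.
  have -> : (CauchySeq aP' - (a k)%:R : cauchy_seq p) n = (a n)%:R - (a k)%:R.
    by rewrite -(cauchy_seq_natE p (a k) n).
  by rewrite padic_abs_distC aC'.
exists x; split.
  by rewrite /= -[x](subrK (a 0%N)%:R) Qp_absD_le ?Qp_abs_nat_le1 //.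
move=> U /nbhs_ballP[e e0 eU].
have [k ke] := rat_expr_lt e0; apply: filterS (aP k) => y yk; apply: eU.
rewrite Qp_ballE /=; apply: le_lt_trans ke.
by rewrite -[x](subrK (a k)%:R) -addrA Qp_absD_le // -opprB Qp_absN.
Qed.
End QpPrime.

(** * Topology of the projective line and Moebius maps *)

Section FieldIdentities.
Variable K : fieldType.
Implicit Types a b c d x y : K.

Lemma invr_sub x y : x != 0 -> y != 0 -> x^-1 - y^-1 = - ((x - y) / (x * y)).
Proof. by move=> x0 y0; field; rewrite ?x0 ?y0. Qed.

Lemma addl_divfK a b c d : c != 0 -> b = a / c * d + (b - a * d / c).
Proof. by move=> c0; field. Qed.

Lemma det_divf a b c d : c != 0 -> a * d - b * c = - c * (b - a * d / c).
Proof. by move=> c0; field. Qed.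
End FieldIdentities.

Section P1Topology.
Variable p : nat.
Hypothesis hp : prime p.
Implicit Types (x y : Qp p) (z : P1Qp p) (U : set (P1Qp p)).

Lemma nbhs_Some x U : nbhs (Some x : P1Qp p) U <->
  exists2 e, 0 < e & forall y, Qp_abs (x - y) < e -> U (Some y).
Proof.
split=> [/nbhs_ballP[e e0 eU]|[e e0 eU]]; first by exists e => // y /eU.
by apply/(@nbhs_ballP _ (Qp p)); exists e.
Qed.

Lemma Qp_scale_continuous (k : Qp p) : continuous ( *%R k : Qp p -> Qp p).
Proof.
move=> x U /nbhs_ballP[e e0 eU]; apply/nbhs_ballP.
have k0 : 0 < Qp_abs k + 1 by rewrite ltr_wpDl ?Qp_abs_ge0.
exists (e / (Qp_abs k + 1)) => /=; first by rewrite divr_gt0.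
move=> y; rewrite Qp_ballE /= ltr_pdivlMr // => xy.
apply: eU; rewrite Qp_ballE /= -mulrBr Qp_absM mulrC.
apply: le_lt_trans xy; apply: ler_wpM2l; first exact: Qp_abs_ge0.
by rewrite lerDl.
Qed.

(** Scaling the unit ball by a large power of [1 / p] covers the ball of radius [R]. Closedness is
    recorded because neighbourhoods of infinity are complements of closed compact sets. *)
Lemma Qp_ball_compact (R : rat) :
  exists2 K : set (Qp p), (compact `&` closed) K & forall x, Qp_abs x <= R -> K x.
Proof.
have [k kR] : exists k, p%:R^-1 ^+ k < (Num.max R 1)^-1.
  by apply: rat_expr_lt => //; rewrite invr_gt0 lt_max ltr01 orbT.
have q0 : (p%:R : Qp p) ^+ k != 0.
  by rewrite expf_neq0 // Qp_nat_eq0 -lt0n prime_gt0.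
exists ( *%R (p%:R ^+ k)^-1 @` [set x : Qp p | Qp_abs x <= 1]).
  have cK : compact ( *%R (p%:R ^+ k)^-1 @` [set x : Qp p | Qp_abs x <= 1]).
    apply: continuous_compact (unit_ball_compact hp).
    by apply: continuous_subspaceT; exact: Qp_scale_continuous.
  by split => //; apply: compact_closed cK; exact: metric_hausdorff.
move=> x xR; exists (p%:R ^+ k * x); last by rewrite mulKf.
rewrite /= Qp_absM Qp_absX Qp_abs_p //.
have R0 : 0 < Num.max R 1 by rewrite lt_max ltr01 orbT.
rewrite -[leRHS](mulVf (lt0r_neq0 R0)) ler_pM ?exprn_ge0 ?invr_ge0 ?ler0n ?Qp_abs_ge0 //.
  exact: ltW.
by rewrite le_max xR.
Qed.

Lemma nbhs_infty U : nbhs (P1_infty p) U <->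
  U (P1_infty p) /\ exists R, forall x, R < Qp_abs x -> U (Some x).
Proof.
split=> [[K [cK _] KU]|[U0 [R RU]]]; last first.
  have [K cK RK] := Qp_ball_compact R; exists K => // _ [[x nKx <-]|->] //.
  by apply: RU; rewrite ltNge; apply/negP => /RK.
split; first by apply: KU; right.
suff [R KR] : exists R, forall x, K x -> Qp_abs x <= R.
  exists R => x xR; apply: KU; left; exists x => // /KR.
  by rewrite leNgt xR.
move: cK => /compact_near_coveringP cK.
(* Compact sets are bounded: near [x] every [R > |x| + 1] bounds the absolute value, and the
   near-covering form of compactness makes [R] uniform on [K]. *)
have [|R [_ KR]] := cK rat (+oo) (fun R x => Qp_abs x <= R) _.
  move=> x _; exists (ball x 1, [set i | Qp_abs x + 1 < i]).
    by split; [exact: nbhsx_ballx|exists (Qp_abs x + 1); split => //;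
      exact: num_real].
  move=> [y i] /= [xy xi]; apply: le_trans (ltW xi).
  rewrite -[y](subKr x); apply: (le_trans (Qp_abs_triangle _ _)).
  by rewrite lerD2l ltW.
by exists (R + 1) => x; apply: KR; rewrite ltrDl.
Qed.
End P1Topology.

Section Mobius.
Variable p : nat.
Hypothesis hp : prime p.
Implicit Types (x y a b c d k : Qp p) (z : P1Qp p).

(** Homogeneous coordinates [[x : y]], on which a Moebius map acts through its matrix. The pair of
    zeros goes to infinity by default, hence the nonvanishing conditions below. *)
Definition pt x y : P1Qp p := if y == 0 then P1_infty p else Some (x / y).

Lemma ptP z : exists x y, [/\ z = pt x y & (x != 0) || (y != 0)].
Proof.
case: z => [x|]; first by exists x, 1; rewrite /pt oner_eq0 divr1 orbT.
by exists 1, 0; rewrite /pt eqxx oner_eq0.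
Qed.

Lemma mobius_pt a b c d x y : (x != 0) || (y != 0) ->
  mobius a b c d (pt x y) = pt (a * x + b * y) (c * x + d * y).
Proof.
rewrite /pt; have [->|y0 _] := eqVneq y 0.
  rewrite orbF !mulr0 !addr0 => x0 /=; rewrite mulf_eq0 (negbTE x0) orbF.
  by case: eqP => // _; rewrite -mulf_div divff // mulr1.
rewrite /=; have -> : c * x + d * y = (c * (x / y) + d) * y.
  by rewrite mulrDl -mulrA divfK.
rewrite mulf_eq0 (negbTE y0) orbF; case: eqP => // _.
congr Some; rewrite -[LHS]mulr1 -(divff y0) mulf_div; congr (_ / _).
by rewrite mulrDl -mulrA divfK.
Qed.

Lemma pt_scale k x y : k != 0 -> pt (k * x) (k * y) = pt x y.
Proof.
move=> k0; rewrite /pt mulf_eq0 (negbTE k0) /=.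
by case: eqP => // _; rewrite -mulf_div divff // mul1r.
Qed.

(** Cramer's rule: the determinant times [x] or [y] is a combination of the two new coordinates. *)
Lemma det_neq0 a b c d x y : a * d - b * c != 0 -> (x != 0) || (y != 0) ->
  (a * x + b * y != 0) || (c * x + d * y != 0).
Proof.
move=> D xy; rewrite -negb_and; apply: contraL xy => /andP[/eqP e1 /eqP e2].
rewrite negb_or !negbK.
have Dx : (a * d - b * c) * x = d * (a * x + b * y) - b * (c * x + d * y) by ring.
have Dy : (a * d - b * c) * y = a * (c * x + d * y) - c * (a * x + b * y) by ring.
move/eqP: Dx; move/eqP: Dy; rewrite e1 e2 !mulr0 subrr !mulf_eq0 (negbTE D) /=.
by move=> -> ->.
Qed.

Lemma mobius_comp a b c d a' b' c' d' z : a' * d' - b' * c' != 0 ->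
  mobius a b c d (mobius a' b' c' d' z) =
  mobius (a * a' + b * c') (a * b' + b * d') (c * a' + d * c') (c * b' + d * d') z.
Proof.
move=> D; have [x [y [-> xy]]] := ptP z.
rewrite !mobius_pt ?det_neq0 //; congr pt; ring.
Qed.

Lemma mobius_scale k a b c d z : k != 0 ->
  mobius (k * a) (k * b) (k * c) (k * d) z = mobius a b c d z.
Proof.
move=> k0; have [x [y [-> xy]]] := ptP z.
by rewrite !mobius_pt // -!mulrA -!mulrDr pt_scale.
Qed.

Lemma mobius_id k z : k != 0 -> mobius k 0 0 k z = z.
Proof.
move=> k0; have [x [y [-> xy]]] := ptP z.
by rewrite mobius_pt // !mul0r addr0 add0r pt_scale.
Qed.

(** The product with the adjugate matrix is a nonzero scalar matrix, which acts trivially on the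
    line. *)
Lemma mobiusK a b c d : a * d - b * c != 0 ->
  cancel (mobius a b c d) (mobius d (- b) (- c) a).
Proof.
move=> D z; rewrite mobius_comp // -[RHS](mobius_id _ D).
by congr mobius; ring.
Qed.

Lemma affine_continuous k b : k != 0 -> continuous (mobius k b 0 1).
Proof.
move=> k0.
have kS x : mobius k b 0 1 (Some x) = Some (k * x + b).
  by rewrite /= mul0r add0r oner_eq0 divr1.
have kN : mobius k b 0 1 (P1_infty p) = P1_infty p by rewrite /= eqxx.
have K0 : 0 < Qp_abs k by rewrite Qp_abs_gt0.
case=> [x|] U; rewrite -/(P1_infty p).
  rewrite kS => /nbhs_Some[e e0 eU]; apply/nbhs_Some.
  exists (e / Qp_abs k) => [|y]; first by rewrite divr_gt0.
  rewrite ltr_pdivlMr // => xy; rewrite /= -/(mobius k b 0 1 (Some y)) kS; apply: eU.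
  have -> : k * x + b - (k * y + b) = (x - y) * k by ring.
  by rewrite Qp_absM.
rewrite kN => /(nbhs_infty hp)[U0 [R RU]]; apply/(nbhs_infty hp).
split; first by rewrite /= -/(mobius k b 0 1 (P1_infty p)) kN.
exists (Num.max R (Qp_abs b) / Qp_abs k) => x.
rewrite ltr_pdivrMr // mulrC -Qp_absM gt_max => /andP[xR xb].
rewrite /= -/(mobius k b 0 1 (Some x)) kS; apply: RU.
suff -> : Qp_abs (k * x + b) = Qp_abs (k * x) by [].
by apply: Qp_abs_iso; rewrite opprD addrA subrr sub0r Qp_absN.
Qed.

Lemma inversion_continuous : continuous (mobius (0 : Qp p) 1 1 0).
Proof.
have iS x : x != 0 -> mobius 0 1 1 0 (Some x) = Some (x^-1).
  by move=> x0; rewrite /= mul0r mul1r add0r addr0 (negbTE x0) div1r.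
have i0 : mobius 0 1 1 0 (Some 0) = P1_infty p by rewrite /= mulr0 addr0 eqxx.
have iN : mobius 0 1 1 0 (P1_infty p) = Some 0 by rewrite /= oner_eq0 mul0r.
set i := mobius _ _ _ _ in iS i0 iN *.
case=> [x|] U; rewrite -/(P1_infty p).
  have [->|x0] := eqVneq x 0.
    rewrite i0 => /(nbhs_infty hp)[U0 [R RU]]; apply/nbhs_Some.
    have R0 : 0 < Num.max R 1 by rewrite lt_max ltr01 orbT.
    exists (Num.max R 1)^-1 => [|y]; first by rewrite invr_gt0.
    rewrite sub0r Qp_absN => yR; change (U (i (Some y))).
    have [->|y0] := eqVneq y 0; first by rewrite i0.
    have Y0 : 0 < Qp_abs y by rewrite Qp_abs_gt0.
    rewrite iS //; apply: RU; rewrite Qp_absV.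
    suff : Num.max R 1 < (Qp_abs y)^-1 by rewrite gt_max => /andP[].
    by rewrite -(invrK (Num.max R 1)) ltf_pV2 ?posrE ?invr_gt0.
  rewrite iS // => /nbhs_Some[e e0 eU]; apply/nbhs_Some.
  have X0 : 0 < Qp_abs x by rewrite Qp_abs_gt0.
  (* The first bound forces [|y| = |x|]; then [|1/x - 1/y| = |x - y| / |x|^2], which the second
     bound makes smaller than [e]. *)
  exists (Num.min (Qp_abs x) (e * (Qp_abs x * Qp_abs x))) => [|y].
    by rewrite lt_min X0 !mulr_gt0.
  rewrite lt_min => /andP[/Qp_abs_iso xy ey].
  have y0 : y != 0 by rewrite -Qp_abs_gt0 xy.
  change (U (i (Some y))); rewrite iS //; apply: eU.
  have -> : x^-1 - y^-1 = - ((x - y) / (x * y)).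
    exact: invr_sub.
  by rewrite Qp_absN Qp_absM Qp_absV Qp_absM xy ltr_pdivrMr // mulr_gt0.
rewrite iN => /nbhs_Some[e e0 eU]; apply/(nbhs_infty hp); split.
  by change (U (i (P1_infty p))); rewrite iN; apply: eU; rewrite subrr Qp_abs0.
exists e^-1 => x xe.
have X0 : 0 < Qp_abs x by apply: lt_trans xe; rewrite invr_gt0.
change (U (i (Some x))); rewrite iS -?Qp_abs_gt0 //; apply: eU.
by rewrite sub0r Qp_absN Qp_absV invf_plt.
Qed.

(** For [c != 0], [(a z + b) / (c z + d) = a / c + (b - a d / c) / (c z + d)] is an inversion
    between two affine maps; for [c = 0] the map is affine. *)
Lemma mobius_continuous a b c d : a * d - b * c != 0 -> continuous (mobius a b c d).
Proof.
have [->|c0] := eqVneq c 0.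
  rewrite mulr0 subr0 mulf_eq0 negb_or => /andP[a0 d0].
  suff -> : mobius a b 0 d = mobius (a / d) (b / d) 0 1.
    by apply: affine_continuous; rewrite mulf_neq0 ?invr_eq0.
  apply/funext => z; rewrite -[RHS](mobius_scale _ _ _ _ _ d0).
  by rewrite mulr0 mulr1 !(mulrC d) !divfK.
move=> D.
have -> : mobius a b c d =
    mobius (b - a * d / c) (a / c) 0 1 \o mobius 0 1 1 0 \o mobius c d 0 1.
  apply/funext => z /=; rewrite [RHS]mobius_comp ?mobius_comp.
  - congr mobius; rewrite ?(mul0r, mul1r, mulr0, mulr1, add0r, addr0) ?divfK //.
    exact: addl_divfK.
  - by rewrite mulr1 mulr0 subr0.
  - by rewrite mul0r mulr1 sub0r oppr_eq0 oner_eq0.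
move=> z; apply: continuous_comp; first exact: affine_continuous.
apply: continuous_comp; first exact: inversion_continuous.
apply: affine_continuous; apply: contraNneq D => D.
have -> : a * d - b * c = - c * (b - a * d / c) by exact: det_divf.
by rewrite D mulr0.
Qed.
End Mobius.

(** * The local group law *)

Section TanhSum.
Variables (K : fieldType) (D : K).
Implicit Types a b c s r t : K.

(** The product of [1 + s sqrt(D)] and [1 + r sqrt(D)], rescaled to rational part 1, has this
    coefficient at [sqrt(D)]. For [D = 1] it is the addition formula of tanh. *)
Definition tsum s r := (s + r) / (1 + D * s * r).

Lemma tsum_frac a m c : m != 0 ->
  tsum (a / m) c = (a + c * m) / (m + D * a * c).
Proof.
move=> m0; rewrite /tsum.
have -> : a / m + c = (a + c * m) / m by field.
have -> : 1 + D * (a / m) * c = (m + D * a * c) / m by field.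
by rewrite invf_div mulrA divfK.
Qed.

Lemma tsumC a b : tsum a b = tsum b a.
Proof. by rewrite /tsum; congr (_ / _); ring. Qed.

Lemma tsumA a b c : 1 + D * a * b != 0 -> 1 + D * b * c != 0 ->
  tsum a (tsum b c) = tsum (tsum a b) c.
Proof.
move=> ab bc; rewrite tsumC tsum_frac // [RHS]tsum_frac //.
by congr (_ / _); ring.
Qed.

Lemma tsumNK t a : 1 - D * a * t != 0 -> 1 - D * t * t != 0 ->
  tsum (tsum a (- t)) t = a.
Proof.
move=> at0 tt0; have at0' : 1 + D * a * - t != 0 by rewrite mulrN.
rewrite {2}/tsum tsum_frac //; apply: (canLR (mulfK _)); last by ring.
by have -> : 1 + D * a * - t + D * (a - t) * t = 1 - D * t * t by ring.
Qed.

Lemma tsumB a b t : 1 + D * a * t != 0 -> 1 + D * b * t != 0 ->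
  tsum a t - tsum b t =
  (a - b) * (1 - D * t * t) / ((1 + D * a * t) * (1 + D * b * t)).
Proof. by move=> a0 b0; rewrite /tsum; field; rewrite ?a0 ?b0. Qed.

Lemma tsum_defect s r : 1 + D * s * r != 0 ->
  s + r - tsum s r = (s + r) * (D * s * r) / (1 + D * s * r).
Proof. by move=> m0; rewrite /tsum; field. Qed.

End TanhSum.

(** * Density of the multiples of a small element *)

Section Local.
Variables (p : nat) (D : Qp p) (eps : rat).
Hypothesis hp : prime p.
Hypothesis eps_ge0 : 0 <= eps.
Hypothesis hD : Qp_abs D * (eps * eps) <= p%:R^-1 ^+ 2.
Implicit Types a b c s r t : Qp p.

Local Notation "s '⊕' r" := (tsum D s r) (at level 45, left associativity).
Local Notation q := (p%:R^-1 : rat).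

Let q_gt0 : 0 < q. Proof. by rewrite invr_gt0 ltr0n prime_gt0. Qed.
Let q_lt1 : q < 1. Proof. by rewrite invf_lt1 ?ltr1n ?prime_gt1 // ltr0n prime_gt0. Qed.
Let q2_lt_q : q ^+ 2 < q. Proof. by rewrite expr2 gtr_pMl. Qed.

Definition tmul n r : Qp p := iter n (tsum D ^~ r) 0.

Lemma Dprod_le s r : Qp_abs s <= eps -> Qp_abs r <= eps ->
  Qp_abs (D * s * r) <= q ^+ 2.
Proof.
move=> se re; apply: le_trans hD; rewrite -mulrA !Qp_absM.
by rewrite ler_wpM2l ?Qp_abs_ge0 // ler_pM ?Qp_abs_ge0.
Qed.

Lemma den_abs s r : Qp_abs s <= eps -> Qp_abs r <= eps ->
  Qp_abs (1 + D * s * r) = 1.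
Proof.
move=> se re; rewrite -[RHS](Qp_abs1 p); apply: Qp_abs_iso.
rewrite opprD addrA subrr sub0r Qp_absN Qp_abs1.
by apply: (le_lt_trans (Dprod_le se re)); exact: lt_trans q_lt1.
Qed.

Lemma den_neq0 s r : Qp_abs s <= eps -> Qp_abs r <= eps -> 1 + D * s * r != 0.
Proof. by move=> se re; rewrite -Qp_abs_gt0 den_abs. Qed.

Lemma denB_abs t s : Qp_abs t <= eps -> Qp_abs s <= eps ->
  Qp_abs (1 - D * t * s) = 1.
Proof. by move=> te se; rewrite -mulrN den_abs ?Qp_absN. Qed.

Lemma denB_neq0 t s : Qp_abs t <= eps -> Qp_abs s <= eps -> 1 - D * t * s != 0.
Proof. by move=> te se; rewrite -Qp_abs_gt0 denB_abs. Qed.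

Section Radius.
Variable rho : rat.
Hypothesis rho_le : rho <= eps.

(** The defect is [(s + r) D s r] divided by a unit. The exponent 2 in [hD] puts it below the scale
    [q * rho] of multiplication by [p]. *)
Lemma tsum_approx s r : Qp_abs s <= rho -> Qp_abs r <= rho ->
  Qp_abs (s + r - s ⊕ r) <= q ^+ 2 * rho.
Proof.
move=> sr rr; have se := le_trans sr rho_le; have re := le_trans rr rho_le.
rewrite (tsum_defect (den_neq0 se re)) 2!Qp_absM Qp_absV den_abs // invr1 mulr1 mulrC.
apply: ler_pM; rewrite ?Qp_abs_ge0 //; first exact: Dprod_le.
exact: Qp_absD_le.
Qed.

Lemma tsum_le s r : Qp_abs s <= rho -> Qp_abs r <= rho -> Qp_abs (s ⊕ r) <= rho.
Proof.
move=> sr rr; have rho0 := le_trans (Qp_abs_ge0 s) sr.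
rewrite -[s ⊕ r](subKr (s + r)); apply: Qp_absB_le; first exact: Qp_absD_le.
apply: (le_trans (tsum_approx sr rr)); rewrite ler_piMl //.
by rewrite ltW // (lt_trans q2_lt_q).
Qed.

Lemma tmul_le n r : Qp_abs r <= rho -> Qp_abs (tmul n r) <= rho.
Proof.
move=> rr; elim: n => [|n IH]; last exact: tsum_le.
by rewrite Qp_abs0 (le_trans _ rr) ?Qp_abs_ge0.
Qed.
End Radius.

(** The errors of the single additions do not accumulate, by the ultrametric inequality. *)
Lemma tmul_approx n r : Qp_abs r <= eps ->
  Qp_abs (n%:R * r - tmul n r) <= q ^+ 2 * Qp_abs r.
Proof.
move=> re; elim: n => [|n IH].
  by rewrite mul0r subrr Qp_abs0 mulr_ge0 ?Qp_abs_ge0 // exprn_ge0 // ltW.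
have -> : n.+1%:R * r - tmul n.+1 r =
    (n%:R * r - tmul n r) + (tmul n r + r - tmul n r ⊕ r).
  by rewrite -natr1 /tmul /=; ring.
by rewrite Qp_absD_le // tsum_approx // tmul_le.
Qed.

(** For [r != 0], [|p r| = q |r|] exceeds the error [q ^+ 2 * |r|], so [p r] and [tmul p r] have the
    same absolute value. *)
Lemma tmul_p_abs r : Qp_abs r <= eps -> Qp_abs (tmul p r) = q * Qp_abs r.
Proof.
have [-> _|r0 re] := eqVneq r 0.
  by apply/eqP; rewrite Qp_abs0 mulr0 eq_le Qp_abs_ge0 andbT tmul_le ?Qp_abs0.
have <- : Qp_abs (p%:R * r) = q * Qp_abs r by rewrite Qp_absM Qp_abs_p.
apply: Qp_abs_iso; apply: (le_lt_trans (tmul_approx p re)).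
by rewrite Qp_absM Qp_abs_p // ltr_pM2r // Qp_abs_gt0.
Qed.

Lemma tsum_tmul n r a : Qp_abs r <= eps -> Qp_abs a <= eps ->
  a ⊕ tmul n r = iter n (tsum D ^~ r) a.
Proof.
move=> re ae; elim: n => [|n IH].
  by rewrite /tmul /tsum /= mulr0 !addr0 divr1.
by rewrite /tmul !iterS -IH tsumA // den_neq0 // tmul_le.
Qed.

Lemma tmul_add m n r : Qp_abs r <= eps -> tmul (m + n) r = tmul n r ⊕ tmul m r.
Proof.
by move=> re; rewrite tsum_tmul // ?tmul_le // /tmul iterD.
Qed.

Lemma tmul_mul m n r : Qp_abs r <= eps -> tmul (m * n) r = tmul m (tmul n r).
Proof.
move=> re; elim: m => [|m IH]; first by rewrite mul0n.
by rewrite mulSn addnC tmul_add // IH tsumC.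
Qed.

Lemma tsum_isometry a b t : Qp_abs a <= eps -> Qp_abs b <= eps ->
  Qp_abs t <= eps -> Qp_abs (a ⊕ t - b ⊕ t) = Qp_abs (a - b).
Proof.
move=> ae be te; rewrite tsumB ?den_neq0 // Qp_absM Qp_absV !Qp_absM.
by rewrite denB_abs // !den_abs // mulr1 invr1 mulr1.
Qed.

(* Base-p expansion of y with respect to r: the first digit j is read off y / r,
   and [tmul p r] is the next scale. *)
Lemma tmul_dense k r y : r != 0 -> Qp_abs r <= eps -> Qp_abs y <= Qp_abs r ->
  exists n, Qp_abs (tmul n r - y) <= q ^+ k * Qp_abs r.
Proof.
elim: k r y => [|k IH] r y r0 re yr.
  by exists 0%N; rewrite /tmul /= sub0r Qp_absN expr0 mul1r.
have R0 : 0 < Qp_abs r by rewrite Qp_abs_gt0.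
have ye := le_trans yr re.
have [|j _ jP] := @Qp_digit p hp (y / r).
  by rewrite Qp_absM Qp_absV ler_pdivrMr // mul1r.
pose t := tmul j r; have tr : Qp_abs t <= Qp_abs r by rewrite tmul_le.
have te := le_trans tr re; have Nte : Qp_abs (- t) <= eps by rewrite Qp_absN.
have q2r : q ^+ 2 * Qp_abs r <= q * Qp_abs r by rewrite ler_pM2r // ltW.
have yt : Qp_abs (y - t) <= q * Qp_abs r.
  have -> : y - t = (y / r - j%:R) * r + (j%:R * r - t).
    by rewrite mulrBl divfK // addrA subrK.
  apply: Qp_absD_le; first by rewrite Qp_absM ler_pM2r.
  exact: le_trans (tmul_approx j re) q2r.
have y'r : Qp_abs (y ⊕ - t) <= Qp_abs (tmul p r).
  rewrite tmul_p_abs // -[_ ⊕ _](subKr (y - t)) Qp_absB_le //.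
  by apply: le_trans q2r; rewrite tsum_approx // Qp_absN.
have [||n nP] := IH (tmul p r) (y ⊕ - t) _ _ y'r.
- by rewrite -Qp_abs_gt0 tmul_p_abs // mulr_gt0.
- exact: tmul_le.
exists (j + n * p)%N.
(* Here [y] becomes [(y ⊕ - t) ⊕ t]; translation by [t] is an isometry, so only the error of the
   recursive call remains. *)
rewrite tmul_add // tmul_mul // -{1}(@tsumNK _ D t y) ?denB_neq0 //.
have pe : Qp_abs (tmul p r) <= eps by exact: tmul_le.
rewrite tsum_isometry //; first last.
- exact: le_trans y'r pe.
- exact: tmul_le.
by apply: (le_trans nP); rewrite tmul_p_abs // mulrA -exprSr.
Qed.

End Local.

(** * The torus action *)

Section Torus.
Variables (p : nat) (D : Qp p).
Hypothesis hp : prime p.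
Hypothesis nsqD : forall e : Qp p, e * e != D.
Implicit Types (u v x y r s : Qp p) (z : P1Qp p).

(** Multiplication by [u + v sqrt(D)], where [[x : y]] stands for [y + x sqrt(D)]; thus [Some 0] is
    the unit element. *)
Definition torus u v : P1Qp p -> P1Qp p := mobius u v (D * v) u.

(** The determinant is the norm of [u + v sqrt(D)], which vanishes only at 0 because [D] is not a
    square. *)
Lemma torus_det u v : (u != 0) || (v != 0) -> u * u - v * (D * v) != 0.
Proof.
have [->|v0 _] := eqVneq v 0.
  by rewrite orbF mul0r subr0 => u0; rewrite mulf_neq0.
rewrite subr_eq0 mulrCA; apply: contra (nsqD (u / v)) => /eqP uv.
by rewrite mulf_div uv mulfK // mulf_neq0.
Qed.

Lemma torus_continuous u v : (u != 0) || (v != 0) -> continuous (torus u v).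
Proof. by move=> uv; apply: mobius_continuous => //; exact: torus_det. Qed.

Lemma torus_mul_neq0 u v x y : (u != 0) || (v != 0) -> (x != 0) || (y != 0) ->
  (u * x + D * v * y != 0) || (v * x + u * y != 0).
Proof.
move=> uv xy; apply: det_neq0 => //.
by rewrite [D * v * v]mulrC; exact: torus_det.
Qed.

Lemma torus_comp u v x y z : (x != 0) || (y != 0) ->
  torus u v (torus x y z) = torus (u * x + D * v * y) (v * x + u * y) z.
Proof.
move=> xy; rewrite /torus mobius_comp; last exact: torus_det.
by congr mobius; ring.
Qed.

Lemma torusC u v x y z : (u != 0) || (v != 0) -> (x != 0) || (y != 0) ->
  torus u v (torus x y z) = torus x y (torus u v z).
Proof. by move=> uv xy; rewrite !torus_comp //; congr torus; ring. Qed.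

Lemma torus_id u z : u != 0 -> torus u 0 z = z.
Proof. by move=> u0; rewrite /torus mulr0 mobius_id. Qed.

Lemma torusK u v : (u != 0) || (v != 0) -> cancel (torus u v) (torus u (- v)).
Proof.
move=> uv z; rewrite torus_comp // -[RHS](torus_id _ (torus_det uv)).
by congr torus; ring.
Qed.

Lemma torusNK u v : (u != 0) || (v != 0) -> cancel (torus u (- v)) (torus u v).
Proof. by move=> uv z; rewrite -{1}[v]opprK torusK // oppr_eq0. Qed.

Lemma torus_transitive z : exists u v,
  (u != 0) || (v != 0) /\ torus u v (Some 0) = z.
Proof.
have [x [y [-> xy]]] := ptP z; exists y, x; rewrite orbC; split => //.
have -> : Some 0 = pt 0 1 :> P1Qp p by rewrite /pt oner_eq0 mul0r.
by rewrite /torus mobius_pt ?oner_eq0 ?orbT //; congr pt; ring.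
Qed.

(** Multiplication by the quotient of the two points, with a conjugate in place of the inverse,
    commutes with [torus u v] since the group is abelian. *)
Lemma torus_homogeneous u v : (u != 0) || (v != 0) -> homogeneous (torus u v).
Proof.
move=> uv z z'; have [x [y [xy <-]]] := torus_transitive z.
have [x' [y' [xy' <-]]] := torus_transitive z'.
have Nxy : (x != 0) || (- y != 0) by rewrite oppr_eq0.
have Nxy' : (x' != 0) || (- y' != 0) by rewrite oppr_eq0.
exists (torus x' y' \o torus x (- y)), (torus x y \o torus x' (- y')); split.
- by move=> t; apply: continuous_comp; exact: torus_continuous.
- by move=> t; apply: continuous_comp; exact: torus_continuous.
- by split=> t /=; rewrite !(torusK, torusNK).
- by move=> t /=; rewrite [torus x _ _]torusC // torusC.
- by rewrite /comp torusK.
Qed.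

Lemma torus_iter u v n : (u != 0) || (v != 0) -> exists x y,
  (x != 0) || (y != 0) /\ forall z, iter n (torus u v) z = torus x y z.
Proof.
move=> uv; elim: n => [|n [x [y [xy IH]]]].
  by exists 1, 0; rewrite oner_eq0; split => // z; rewrite torus_id ?oner_eq0.
eexists; eexists; split; first exact: (torus_mul_neq0 uv xy).
by move=> z; rewrite iterS IH torus_comp.
Qed.

Hypothesis inf_order : forall n, (0 < n)%N -> iter n (torus 1 1) <> id.
Variable eps : rat.
Hypothesis eps_ge0 : 0 <= eps.
Hypothesis hD : Qp_abs D * (eps * eps) <= p%:R^-1 ^+ 2.

(* Two points of an orbit close to an accumulation point differ by an iterate
   that is close to the identity. *)
Lemma torus_small_iterate delta : 0 < delta -> delta <= eps -> exists k r,
  [/\ (0 < k)%N, r != 0, Qp_abs r < delta &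
      forall z, iter k (torus 1 1) z = torus 1 r z].
Proof.
move=> d0 de; have uv1 : ((1 : Qp p) != 0) || ((1 : Qp p) != 0) by rewrite oner_eq0.
pose s n := iter n (torus 1 1) (Some 0).
have [z [_ sz]] : [set: P1Qp p] `&` cluster (s @ \oo) !=set0.
  by apply: (@one_point_compactification_compact (Qp p)); exact: filterT.
have [x [y [xy zE]]] := torus_transitive z.
have Nxy : (x != 0) || (- y != 0) by rewrite oppr_eq0.
(* The translation [torus x (- y)] moves the accumulation point [z] to [Some 0], so orbit points in
   [W] get small coordinates. *)
pose W := torus x (- y) @^-1` [set t | exists2 a, Qp_abs a < delta & t = Some a].
have Wz : nbhs z W.
  apply: torus_continuous => //; rewrite -zE torusK //.
  apply/nbhs_Some; exists delta => // a; rewrite sub0r Qp_absN => ad.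
  by exists a.
have hit N : exists2 n, (N <= n)%N & W (s n).
  have sN : (s @ \oo) [set s n | n in [set n | (N <= n)%N]].
    by exists N => // n /= Nn; exists n.
  by have [_ [[n Nn <-] Wn]] := sz _ _ sN Wz; exists n.
have [n _ [a ad an]] := hit 0%N.
have [m nm [b bd bm]] := hit n.+1.
have [u [v [uv kE]]] := torus_iter (m - n) uv1.
have k0 : (0 < m - n)%N by rewrite subn_gt0.
have ab : torus u v (Some a) = Some b.
  rewrite -an -bm torusC // -kE; congr torus.
  by rewrite /s -iterD subnK // ltnW.
have ae : Qp_abs a <= eps by rewrite (le_trans (ltW ad)).
have be : Qp_abs b <= eps by rewrite (le_trans (ltW bd)).
(* This solves [torus u v (Some a) = Some b] for [v / u]: since [1 - D b a] is a unit,
   [|v / u| = |b - a| < delta]. *)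
have uvE : v * (1 - D * b * a) = u * (b - a).
  move: ab; rewrite /torus /=; case: eqP => // /eqP m0 [bE].
  have : u * a + v = b * (D * v * a + u) by rewrite -bE divfK.
  move=> E; apply/eqP; rewrite -subr_eq0; apply/eqP.
  have -> : v * (1 - D * b * a) - u * (b - a) = u * a + v - b * (D * v * a + u).
    by ring.
  by rewrite E subrr.
have vE : Qp_abs v = Qp_abs u * Qp_abs (b - a).
  by rewrite -Qp_absM -uvE Qp_absM (denB_abs hp hD) // mulr1.
have u0 : u != 0.
  apply: contraTneq uv => u0; move: vE; rewrite u0 Qp_abs0 mul0r.
  by move=> /eqP; rewrite Qp_abs_eq0 eqxx => ->.
have rE t : torus u v t = torus 1 (v / u) t.
  rewrite /torus -[RHS](mobius_scale _ _ _ _ _ u0) mulr1.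
  congr mobius; first by rewrite mulrC divfK.
  by rewrite mulrCA [u * _]mulrC divfK.
exists (m - n)%N, (v / u); split => //.
- apply/eqP => r0; apply: (inf_order k0); apply/funext => t.
  by rewrite kE rE r0 torus_id // oner_eq0.
- rewrite Qp_absM Qp_absV ltr_pdivrMr ?Qp_abs_gt0 // vE mulrC.
  by rewrite ltr_pM2r ?Qp_abs_gt0 // Qp_absB_lt.
- by move=> t; rewrite kE rE.
Qed.

(** The iterates stay in the ball of radius [eps], where the denominators are units, so infinity is
    never reached. *)
Lemma torus_iter_Some r n : Qp_abs r <= eps ->
  iter n (torus 1 r) (Some 0) = Some (tmul D n r).
Proof.
move=> re; elim: n => [//|n IH]; rewrite iterS IH /torus /= mul1r.
have ne : Qp_abs (tmul D n r) <= eps by exact: (tmul_le hp hD).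
have -> : D * r * tmul D n r + 1 = 1 + D * tmul D n r * r by ring.
by rewrite (negbTE (den_neq0 hp hD ne re)).
Qed.

Lemma torus_orbit_nbhs : 0 < eps ->
  nbhs (Some 0 : P1Qp p) (orbit_closure (torus 1 1) (Some 0)).
Proof.
move=> e0; have [k [r [k0 r0 /ltW re kr]]] := torus_small_iterate e0 (lexx _).
apply/nbhs_Some; exists (Qp_abs r); first by rewrite Qp_abs_gt0.
move=> y; rewrite sub0r Qp_absN => /ltW yr U /nbhs_Some[e he eU].
have R0 : 0 < Qp_abs r by rewrite Qp_abs_gt0.
have [l le] := rat_expr_lt hp (divr_gt0 he R0).
have [n nP] := tmul_dense hp eps_ge0 hD l r0 re yr.
exists (Some (tmul D n r)); split; last first.
  apply: eU; rewrite -Qp_absN opprB; apply: le_lt_trans nP _.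
  by rewrite -ltr_pdivlMr.
exists (n * k)%N => //; rewrite -torus_iter_Some // iterM.
by apply: eq_iter.
Qed.

Lemma torus_recurrent N : 0 < eps ->
  orbit_closure (torus 1 1) (iter N (torus 1 1) (Some 0)) (Some 0).
Proof.
move=> e0 U /nbhs_Some[e he eU].
have [||k [r [k0 r0 re kr]]] := @torus_small_iterate (Num.min e eps).
- by rewrite lt_min he.
- by rewrite ge_min lexx orbT.
move: re; rewrite lt_min => /andP[re /ltW reps].
exists (Some (tmul D N r)); split; last first.
  by apply: eU; rewrite sub0r Qp_absN; apply: le_lt_trans re; exact: (tmul_le hp hD).
(* The total is then [N * k] steps, that is [N] translations by [r], and [tmul N r] is as small as
   [r]. As [k > 0], the subtraction is exact. *)
exists (N * k - N)%N => //.
rewrite -iterD subnK ?leq_pmulr // -torus_iter_Some // iterM.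
exact: eq_iter.
Qed.

End Torus.

(** * Normal form *)

Lemma torus_decomposition (p : nat) (D : Qp p) : prime p ->
  (forall e : Qp p, e * e != D) ->
  (forall n, (0 < n)%N -> iter n (torus D 1 1) <> id) ->
  exists (M : nat) (F : 'I_M -> set (P1Qp p)),
    minimal_decomposition (torus D 1 1) F.
Proof.
move=> hp nsq ord; have one0 : ((1 : Qp p) != 0) || ((1 : Qp p) != 0).
  by rewrite oner_eq0.
have p0 : 0 < p%:R :> rat by rewrite ltr0n prime_gt0.
have D0 : 0 < Qp_abs D + 1 by rewrite ltr_wpDl ?Qp_abs_ge0.
(* The square of [|D| + 1] is at least [|D|], which gives the bound [De]. *)
pose eps : rat := p%:R^-1 / (Qp_abs D + 1).
have e0 : 0 < eps by rewrite divr_gt0 ?invr_gt0.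
have De : Qp_abs D * (eps * eps) <= p%:R^-1 ^+ 2.
  have A1 : 1 <= Qp_abs D + 1 by rewrite lerDr Qp_abs_ge0.
  rewrite /eps mulf_div mulrCA -expr2 ler_piMr ?exprn_ge0 ?invr_ge0 ?(ltW p0) //.
  rewrite ler_pdivrMr ?mul1r ?mulr_gt0 //.
  by rewrite (@le_trans _ _ (Qp_abs D + 1)) ?lerDl // ler_peMr // ltW.
apply: (@minimal_decomposition_exists (P1Qp p) _ _ _ (Some 0)).
- exact: torus_continuous.
- exact: torus_homogeneous.
- exact: (torus_orbit_nbhs hp nsq ord (ltW e0) De e0).
- by move=> N; exact: (torus_recurrent hp nsq ord De N e0).
- exact: one_point_compactification_compact.
Qed.

Section NormalForm.
Variables (p : nat) (a b c d : Qp p).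
Hypothesis hp : prime p.
Hypothesis det0 : a * d - b * c != 0.
Hypothesis nofix : forall z : P1Qp p, mobius a b c d z <> z.
Hypothesis inf_order :
  forall n, (0 < n)%N -> iter n (mobius a b c d) <> id.

Definition disc : Qp p := (d - a) ^+ 2 + 4%:R * b * c.
(** With [s] a square root of [disc] and [t = a + d], this is [(s / t)^2 = ((lambda - 1) / (lambda +
    1))^2]. *)
Definition rdisc : Qp p := disc / (a + d) ^+ 2.

Lemma lower_neq0 : c != 0.
Proof.
by apply/eqP => c0; apply: (nofix (z := P1_infty p)); rewrite /= c0 eqxx.
Qed.

(** By Cayley-Hamilton a traceless matrix has a scalar square, so the second iterate would be the
    identity. *)
Lemma trace_neq0 : a + d != 0.
Proof.
apply/eqP => t0; apply: (@inf_order 2) => //; apply/funext => z /=.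
have dE : d = - a by apply/eqP; rewrite -addr_eq0 addrC t0.
rewrite mobius_comp // -[RHS](mobius_id z (_ : b * c - a * d != 0)).
  by congr mobius; rewrite dE; ring.
by rewrite -opprB oppr_eq0.
Qed.

(** As the right side is nonzero, [rdisc] is not 1 and the denominator of [lambda] does not
    vanish. *)
Lemma trace_disc : (a + d) ^+ 2 - disc = 4%:R * (a * d - b * c).
Proof. by rewrite /disc; ring. Qed.

Lemma trace_disc_neq0 : (a + d) ^+ 2 - disc != 0.
Proof. by rewrite trace_disc mulf_neq0 // Qp_nat_eq0. Qed.

Let t2_neq0 : (a + d) ^+ 2 != 0. Proof. by rewrite expf_neq0 // trace_neq0. Qed.

Lemma rdiscK : rdisc * (a + d) ^+ 2 = disc.
Proof. by rewrite /rdisc divfK. Qed.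

Let det1 : 1 * 1 - 1 * (rdisc * 1) != 0 :> Qp p.
Proof.
apply: contraNneq trace_disc_neq0 => D1; apply/eqP.
by rewrite -rdiscK -[X in X - _]mul1r -mulrBl; move: D1;
  rewrite !mulr1 !mul1r => ->; rewrite mul0r.
Qed.

(* If A is the matrix of phi and t its trace, then (2A - t)^2 = disc; the columns
   of [straighten] are (2A - t) e1 and t e1. *)
Definition straighten : P1Qp p -> P1Qp p := mobius (a - d) (a + d) (2%:R * c) 0.
Definition straighten_inv : P1Qp p -> P1Qp p :=
  mobius 0 (- (a + d)) (- (2%:R * c)) (a - d).

Let straighten_det : (a - d) * 0 - (a + d) * (2%:R * c) != 0.
Proof.
rewrite mulr0 sub0r oppr_eq0 !mulf_neq0 ?trace_neq0 ?lower_neq0 //.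
by rewrite Qp_nat_eq0.
Qed.

Let straighten_inv_det : 0 * (a - d) - - (a + d) * - (2%:R * c) != 0.
Proof.
by have -> : 0 * (a - d) - - (a + d) * - (2%:R * c) =
    (a - d) * 0 - (a + d) * (2%:R * c) by ring.
Qed.

Lemma straighten_torus z : straighten (torus rdisc 1 1 z) = mobius a b c d (straighten z).
Proof.
rewrite /straighten /torus mobius_comp // mobius_comp //.
have two0 : 2%:R != 0 :> Qp p by rewrite Qp_nat_eq0.
(* The matrices of the two sides are proportional: [a + d] times the left one is 2 times the right
   one. *)
rewrite -[LHS](mobius_scale _ _ _ _ _ trace_neq0).
rewrite -[RHS](mobius_scale _ _ _ _ _ two0).
have E : (a + d) * ((a - d) * 1 + (a + d) * (rdisc * 1)) =
    2%:R * (a * (a - d) + b * (2%:R * c)).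
  transitivity ((a + d) * (a - d) + rdisc * (a + d) ^+ 2); first by ring.
  by rewrite rdiscK /disc; ring.
by rewrite E; congr mobius; ring.
Qed.

Lemma straighten_continuous : continuous straighten.
Proof. exact: mobius_continuous. Qed.

Lemma straighten_inv_continuous : continuous straighten_inv.
Proof. exact: mobius_continuous. Qed.

Lemma straightenK : cancel straighten straighten_inv.
Proof. exact: mobiusK. Qed.

Lemma straighten_invK : cancel straighten_inv straighten.
Proof. by have := mobiusK straighten_inv_det; rewrite !opprK. Qed.

(** Otherwise [[1 : e]] is an eigenvector of the torus matrix with eigenvalue [1 + e], and
    [straighten] sends it to a fixed point of the original map. *)
Lemma rdisc_nonsquare e : e * e != rdisc.
Proof.
apply/eqP => eD.
have e1 : 1 + e != 0.
  apply: contraNneq det1 => e1; rewrite -eD.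
  have -> : e = -1 by apply/eqP; rewrite -addr_eq0 addrC e1.
  by apply/eqP; ring.
have x0 : ((1 : Qp p) != 0) || (e != 0) by rewrite oner_eq0.
apply: (nofix (z := straighten (pt 1 e))); rewrite -straighten_torus; congr straighten.
rewrite /torus mobius_pt // -[RHS](pt_scale 1 e e1) -eD; congr pt; ring.
Qed.

Lemma torus_inf_order n : (0 < n)%N -> iter n (torus rdisc 1 1) <> id.
Proof.
move=> n0 tn; apply: (inf_order n0); apply/funext => z.
by rewrite -[z]straighten_invK -(iter_morph straighten_torus) tn.
Qed.

Lemma mobius_homogeneous : homogeneous (mobius a b c d).
Proof.
apply: (homogeneous_conjugate straighten_continuous straighten_inv_continuous straightenK
  straighten_invK straighten_torus).
by apply: torus_homogeneous; [exact: hp|exact: rdisc_nonsquare|rewrite oner_eq0].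
Qed.

Lemma mobius_decomposition :
  exists (M : nat) (F : 'I_M -> set (P1Qp p)),
    minimal_decomposition (mobius a b c d) F.
Proof.
have [M [F dF]] := torus_decomposition hp rdisc_nonsquare torus_inf_order.
exists M, (fun i => straighten @` F i).
exact: (minimal_decomposition_conjugate straighten_continuous straighten_inv_continuous
  straightenK straighten_invK straighten_torus dF).
Qed.

Lemma torus_decomposition_of M (F : 'I_M -> set (P1Qp p)) :
  minimal_decomposition (mobius a b c d) F ->
  exists F' : 'I_M -> set (P1Qp p), minimal_decomposition (torus rdisc 1 1) F'.
Proof.
move=> dF; exists (fun i => straighten_inv @` F i).
apply: (minimal_decomposition_conjugate straighten_inv_continuous straighten_continuous
  straighten_invK straightenK _ dF).
exact: conjugate_sym straightenK straighten_invK straighten_torus.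
Qed.

Lemma lambda_den_neq0 (K : fieldType) (iota : {rmorphism Qp p -> K}) (s : K) :
  s ^+ 2 = iota disc -> iota (a + d) - s != 0.
Proof.
move=> sD; rewrite subr_eq0; apply: contraNneq trace_disc_neq0 => ts.
by rewrite subr_eq0 -(inj_eq (fmorph_inj iota)) rmorphXn -sD ts.
Qed.

End NormalForm.

(** Clearing denominators leaves [2 (s t' - s' t) = 0]; squaring [s t' = s' t] eliminates the chosen
    square roots. *)
Lemma rdisc_of_lambda (p : nat) (K : fieldType) (iota : {rmorphism Qp p -> K})
    (a b c d a' b' c' d' : Qp p) (s s' : K) :
  a + d != 0 -> a' + d' != 0 ->
  s ^+ 2 = iota (disc a b c d) -> s' ^+ 2 = iota (disc a' b' c' d') ->
  iota (a + d) - s != 0 -> iota (a' + d') - s' != 0 ->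
  (iota (a + d) + s) / (iota (a + d) - s) =
    (iota (a' + d') + s') / (iota (a' + d') - s') ->
  rdisc a b c d = rdisc a' b' c' d'.
Proof.
move=> t0 t'0 sD s'D m0 m'0 /eqP; rewrite eqr_div // => /eqP E.
apply/eqP; rewrite /rdisc eqr_div ?expf_neq0 //.
have iM x y : iota (x * y ^+ 2) = iota x * iota y ^+ 2 by rewrite rmorphM rmorphXn.
rewrite -(inj_eq (fmorph_inj iota)) !iM -sD -s'D.
set t := iota _ in E *; set t' := iota _ in E *.
suff st : s * t' = s' * t by rewrite -!exprMn st.
have two0 : 2%:R != 0 :> K by rewrite -(rmorph_nat iota) fmorph_eq0 Qp_nat_eq0.
apply/eqP; rewrite -subr_eq0 -(mulrI_eq0 _ (mulfI two0)); apply/eqP.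
have -> : 2%:R * (s * t' - s' * t) = (t + s) * (t' - s') - (t' + s') * (t - s).
  by ring.
by rewrite E subrr.
Qed.

Theorem theorem1p1 (p : nat) (hp : prime p) :
  (forall a b c d : Qp p,
      a * d - b * c != 0 ->
      (forall z : P1Qp p, mobius a b c d z <> z) ->
      (forall n : nat, (0 < n)%N -> iter n (mobius a b c d) <> id) ->
      (exists (M : nat) (F : 'I_M -> set (P1Qp p)),
          minimal_decomposition (mobius a b c d) F) /\
      (forall (M : nat) (F : 'I_M -> set (P1Qp p)),
          minimal_decomposition (mobius a b c d) F ->
          forall i j : 'I_M,
            conjugate_subsystems (mobius a b c d) (F i) (F j))) /\
  (forall (K : closedFieldType) (iota : {rmorphism Qp p -> K}),
      (forall z : K, algebraicOver iota z) ->
      exists N : K -> nat,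
        forall (a b c d : Qp p) (sqrtDelta : K),
          a * d - b * c != 0 ->
          (forall z : P1Qp p, mobius a b c d z <> z) ->
          (forall n : nat, (0 < n)%N -> iter n (mobius a b c d) <> id) ->
          sqrtDelta ^+ 2 = iota ((d - a) ^+ 2 + 4%:R * b * c) ->
          forall (M : nat) (F : 'I_M -> set (P1Qp p)),
            minimal_decomposition (mobius a b c d) F ->
            M = N ((iota (a + d) + sqrtDelta) / (iota (a + d) - sqrtDelta))).
Proof.
split=> [a b c d D0 nofix ord|K iota _].
  split; first exact: mobius_decomposition.
  move=> M F [_ _ mF] i j.
  by apply: minimal_conjugate (mF i).2 (mF j).2 (mF i).1 (mF j).1;
    exact: mobius_homogeneous.
(* The value of [N] at [l] is some count realized by a map with this [l], or 0 if there is none. It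
   remains to see that all realized counts agree. *)
pose counts (l : K) := [set M | exists a b c d s,
  [/\ a * d - b * c != 0, forall z : P1Qp p, mobius a b c d z <> z,
      forall n, (0 < n)%N -> iter n (mobius a b c d) <> id,
      s ^+ 2 = iota (disc a b c d) /\
        l = (iota (a + d) + s) / (iota (a + d) - s) &
      exists F : 'I_M -> set (P1Qp p), minimal_decomposition (mobius a b c d) F]].
exists (fun l => xget 0%N (counts l)) => a b c d s D0 nofix ord sD M F dF.
set l := _ / _.
have : counts l M by exists a, b, c, d, s; split => //; exists F.
move=> /(xgetI 0%N); set M' := xget _ _.
move=> [a' [b' [c' [d' [s' [D0' nofix' ord' [sD' ll'] [F' dF']]]]]]].
(* Each map is conjugate to the torus map of its [rdisc]. Equal values of [lambda] give equal
   [rdisc], so both counts belong to one map. *)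
have [G dG] := torus_decomposition_of hp D0 nofix ord dF.
have [G' dG'] := torus_decomposition_of hp D0' nofix' ord' dF'.
have E : rdisc a b c d = rdisc a' b' c' d'.
  apply: (rdisc_of_lambda _ _ sD sD' _ _ ll').
  - exact: trace_neq0 ord.
  - exact: trace_neq0 ord'.
  - exact: lambda_den_neq0 sD.
  - exact: lambda_den_neq0 sD'.
by rewrite E in dG; exact: minimal_decomposition_unique dG dG'.
Qed.
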